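(* Let $1\le m\le n$ be integers. For almost all (with respect to Lebesgue measure) real symmetric matrices $A\in\mathbb{R}^{n\times n}$, the following algorithm converges locally quadratically to the orthogonal projector $P^{*}\in\mathrm{Gr}_{m,n}$ onto the $m$-dimensional dominant eigenspace of $A$ (the sum of the eigenspaces of the $m$ largest eigenvalues). Algorithm. Pick $\Theta_0\in \mathrm{SO}_n$ and put $P_0=\Theta_0^{\top}\begin{bmatrix}I_m&0\\0&0\end{bmatrix}\Theta_0$. For $j=0,1,2,\dots$: (i) compute the blocks $\begin{bmatrix}A_{11}&A_{12}\\ A_{12}^{\top}&A_{22}\end{bmatrix}=\Theta_jA\Theta_j^{\top}$ with $A_{11}\in\mathbb{R}^{m\times m}$; (ii) solve the Sylvester equation $A_{11}Z_j-Z_jA_{22}=-A_{12}$ for $Z_j\in\mathbb{R}^{m\times(n-m)}$; (iii) set $\Theta_{j+1}^{\top}=\Theta_j^{\top}\begin{bmatrix}I_m&Z_j\\-Z_j^{\top}&I_{n-m}\end{bmatrix}_{Q}$ and $P_{j+1}=\Theta_{j+1}^{\top}\begin{bmatrix}I_m&0\\0&0\end{bmatrix}\Theta_{j+1}$.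
   Context: $\mathrm{Gr}_{m,n}=\{P\in\mathbb{R}^{n\times n}: P^{\top}=P,\ P^2=P,\ \operatorname{tr}P=m\}$. $\mathrm{SO}_n$ is the group of real orthogonal $n\times n$ matrices of determinant $1$. For an invertible real matrix $M$, $M_Q$ denotes the orthogonal factor in the unique factorization $M=M_QM_R$ with $M_Q$ orthogonal and $M_R$ upper triangular with positive diagonal. ''The algorithm converges locally quadratically to $P^{*}$'' means: there are a neighborhood $V\subset\mathrm{Gr}_{m,n}$ of $P^{*}$ and a constant $C$ such that, for every $\Theta_0\in\mathrm{SO}_n$ with $P_0\in V$, all steps are well defined (the Sylvester equations are uniquely solvable), $P_j\to P^{*}$, and $\|P_{j+1}-P^{*}\|\le C\|P_j-P^{*}\|^2$ for all $j$. *)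

(* Defs.v *)
From HB Require Import structures.
From mathcomp Require Import all_boot all_order all_algebra.
From mathcomp Require Import all_classical all_reals all_analysis.

Set Implicit Arguments.
Unset Strict Implicit.
Unset Printing Implicit Defensive.

Import Order.TTheory GRing.Theory Num.Theory.
Import numFieldNormedType.Exports.

Local Open Scope classical_set_scope.
Local Open Scope ring_scope.

Definition tcons (R : realType) d
    (p : measurableTypeR R * d.-tuple (measurableTypeR R)) :
  d.+1.-tuple (measurableTypeR R) := [tuple of p.1 :: p.2].

Lemma measurable_tcons (R : realType) d :
  measurable_fun [set: measurableTypeR R * d.-tuple (measurableTypeR R)]
    (@tcons R d).
Proof. exact: measurable_cons. Qed.

(* Lebesgue measure on R^d, as the d-fold product of the Lebesgue measure on
   the line: the library only has the product of two measures. *)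
Fixpoint lebesgue_tuple (R : realType) d :
    set (d.-tuple (measurableTypeR R)) -> \bar R :=
  if d is d'.+1
  then pushforward (@lebesgue_measure R \x @lebesgue_tuple R d')%E (@tcons R d')
  else \d_[tuple].

Lemma sigma_finite_product d1 d2 (T1 : measurableType d1)
    (T2 : measurableType d2) (R : realType)
    (m1 : {sigma_finite_measure set T1 -> \bar R})
    (m2 : {sigma_finite_measure set T2 -> \bar R}) :
  sigma_finite setT (m1 \x m2)%E.
Proof.
have [F TF Foo] := sigma_finiteT m1; have [G TG Goo] := sigma_finiteT m2.
pose H ij := F ij.1 `*` G ij.2.
exists (fun i => if unpickle i is Some ij then H ij else set0).
  apply/esym; rewrite -subTset => -[x y] _.
  have [i _ Fx] : (\bigcup_i F i) x by rewrite -TF.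
  have [j _ Gy] : (\bigcup_i G i) y by rewrite -TG.
  by exists (pickle (i, j)) => //; rewrite pickleK; split.
move=> i; case: unpickle => [[a b]|]; last by rewrite measure0.
have [mF Fa] := Foo a; have [mG Gb] := Goo b.
split; first exact: measurableX.
by rewrite product_measure1E// lte_mul_pinfty// ge0_fin_numE.
Qed.

Section LebesgueTupleMeasure.
Context (R : realType) (d : nat).
Notation RT := (measurableTypeR R).
Variable mu : {sigma_finite_measure set (d.-tuple RT) -> \bar R}.

Definition lebesgue_step : set (d.+1.-tuple RT) -> \bar R :=
  pushforward (@lebesgue_measure R \x mu)%E (@tcons R d).

Local Notation nu := lebesgue_step.

Let pre (A : set (d.+1.-tuple RT)) :
  measurable A -> measurable (@tcons R d @^-1` A).
Proof.
by move=> mA; rewrite -[X in measurable X]setTI; exact: measurable_tcons.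
Qed.

Let nu0 : nu set0 = 0%E.
Proof. by rewrite /lebesgue_step /pushforward preimage_set0 measure0. Qed.

Let nu_ge0 A : (0 <= nu A)%E.
Proof. by apply: integral_ge0 => x _; exact: measure_ge0. Qed.

Let nu_sigma_additive : semi_sigma_additive nu.
Proof.
move=> F mF tF mUF; rewrite /lebesgue_step /pushforward preimage_bigcup.
apply: measure_semi_sigma_additive.
- by move=> n; exact: pre.
- apply/trivIsetP => /= i j _ _ ij; rewrite -preimage_setI.
  by move/trivIsetP : tF => /(_ _ _ _ _ ij) ->//; rewrite preimage_set0.
- by rewrite -preimage_bigcup; exact: pre.
Qed.

HB.instance Definition _ :=
  isMeasure.Build _ _ _ nu nu0 nu_ge0 nu_sigma_additive.

Let uncons (t : d.+1.-tuple RT) : RT * d.-tuple RT :=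
  (thead t, [tuple of behead t]).

Let tconsK : cancel (@tcons R d) uncons.
Proof.
by case=> x t; rewrite /uncons /tcons theadE; congr pair; exact: val_inj.
Qed.

Let munconsT : measurable_fun setT uncons.
Proof.
by apply: measurable_fun_pair; [exact: measurable_tnth|exact: measurable_behead].
Qed.

Let nu_sigma_finite : sigma_finite setT nu.
Proof.
have [F FT Foo] := sigma_finite_product (@lebesgue_measure R) mu.
exists (fun i => uncons @^-1` F i).
  by rewrite -preimage_bigcup -FT preimage_setT.
move=> i; have [mF Fi] := Foo i; split.
  by rewrite -[X in measurable X]setTI; exact: munconsT.
rewrite /lebesgue_step /pushforward.
have -> : @tcons R d @^-1` (uncons @^-1` F i) = F i; last exact: Fi.
by apply/seteqP; split=> p /=; rewrite tconsK.
Qed.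

HB.instance Definition _ :=
  Measure_isSigmaFinite.Build _ _ _ nu nu_sigma_finite.

Lemma lebesgue_tuple_step :
  exists nu' : {sigma_finite_measure set (d.+1.-tuple RT) -> \bar R},
    (nu' : set _ -> \bar R) = nu.
Proof. by exists lebesgue_step. Qed.

End LebesgueTupleMeasure.

Section LebesgueTupleInstances.
Context (R : realType) (d : nat).
Notation RT := (measurableTypeR R).
Notation mu := (@lebesgue_tuple R d).

Lemma lebesgue_tuple_sigma_finite_measure :
  exists nu : {sigma_finite_measure set (d.-tuple RT) -> \bar R},
    (nu : set _ -> \bar R) = mu.
Proof.
elim: d => [|e [nu nuE]]; first by exists \d_[tuple].
by have [nu' nu'E] := lebesgue_tuple_step nu; exists nu';
   rewrite nu'E /lebesgue_step nuE.
Qed.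

Let mu0 : mu set0 = 0%E.
Proof.
by have [nu <-] := lebesgue_tuple_sigma_finite_measure; exact: measure0.
Qed.

Let mu_ge0 A : (0 <= mu A)%E.
Proof.
by have [nu <-] := lebesgue_tuple_sigma_finite_measure; exact: measure_ge0.
Qed.

Let mu_sigma_additive : semi_sigma_additive mu.
Proof.
have [nu <-] := lebesgue_tuple_sigma_finite_measure.
exact: measure_semi_sigma_additive.
Qed.

HB.instance Definition _ :=
  isMeasure.Build _ _ _ mu mu0 mu_ge0 mu_sigma_additive.

Let mu_sigma_finite : sigma_finite setT mu.
Proof.
by have [nu <-] := lebesgue_tuple_sigma_finite_measure; exact: sigma_finiteT.
Qed.

HB.instance Definition _ :=
  Measure_isSigmaFinite.Build _ _ _ mu mu_sigma_finite.

End LebesgueTupleInstances.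

Lemma lebesgue_tuple_box (R : realType) d
    (B : 'I_d -> set (measurableTypeR R)) :
  (forall i, measurable (B i)) ->
  lebesgue_tuple [set x | forall i, B i (tnth x i)] =
  (\prod_(i < d) lebesgue_measure (B i))%E.
Proof.
elim: d B => [|d IH] B mB.
  rewrite big_ord0 /= diracE mem_set//=.
  by case.
rewrite big_ord_recl -IH//= /pushforward.
rewrite -product_measure1E//; last first.
  rewrite [X in measurable X](_ : _ =
    \bigcap_(i in [set: 'I_d]) (@tnth d _ ^~ i @^-1` B (lift ord0 i))).
    apply: fin_bigcap_measurable; first exact: finite_finset.
    move=> i _; rewrite -[X in measurable X]setTI.
    exact: measurable_tnth.
  by apply/seteqP; split=> x /= H i; [move=> _; exact: H|exact: H].
congr (product_measure1 _ _ _); apply/seteqP; split=> -[x t] /=.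
  move=> H; split; first by have := H ord0; rewrite (tnth_nth x).
  by move=> i; have := H (lift ord0 i); rewrite /tcons /= tnthS.
move=> [Hx Ht] i; case: (unliftP ord0 i) => [j|] ->.
  by rewrite /tcons /= tnthS; exact: Ht.
by rewrite (tnth_nth x).
Qed.

Section SymmetricMatrices.
Context (R : realType) (n : nat).

Definition upper_index := {p : 'I_n * 'I_n | (p.1 <= p.2)%N}.

(* The entries on and above the diagonal; restricted to symmetric matrices this
   is a linear isomorphism onto R^(n(n+1)/2), which is how Lebesgue measure on
   the space of symmetric matrices is understood. *)
Definition sym_coord (A : 'M[R]_n) :
    #|{: upper_index}|.-tuple (measurableTypeR R) :=
  [tuple A (val (enum_val i)).1 (val (enum_val i)).2 | i < #|{: upper_index}|].

Definition almost_all_symmetric (P : 'M[R]_n -> Prop) : Prop :=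
  (@lebesgue_tuple R _).-negligible
    (sym_coord @` [set A : 'M[R]_n | A^T = A /\ ~ P A]).

End SymmetricMatrices.

Section Orthogonal.
Context (R : realType) (n : nat).
Implicit Types (M Q T : 'M[R]_n).

Definition orthogonal_mx Q : Prop := Q^T *m Q = 1%:M.

Definition SO : set 'M[R]_n := [set Q | orthogonal_mx Q /\ \det Q = 1].

Definition upper_triangular_pos T : Prop :=
  (forall i j : 'I_n, (j < i)%N -> T i j = 0) /\ (forall i, 0 < T i i).

(* M_Q; the default value 1 is never used for an invertible M. *)
Definition qr_Q M : 'M[R]_n :=
  xget 1%:M [set Q | orthogonal_mx Q /\
                     exists2 T, upper_triangular_pos T & M = Q *m T].

End Orthogonal.

(* Throughout, n = m + k. *)
Section Algorithm.
Context (R : realType) (m k : nat).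
Local Notation mat := 'M[R]_(m + k).
Implicit Types (A P Theta : mat) (Z : 'M[R]_(m, k)).

Definition Gr : set mat :=
  [set P | [/\ P^T = P, P *m P = P & \tr P = m%:R]].

Definition proj_of Theta : mat :=
  Theta^T *m block_mx 1%:M 0 0 0 *m Theta.

Definition sylvester A Theta Z : Prop :=
  let B := Theta *m A *m Theta^T in
  ulsubmx B *m Z - Z *m drsubmx B = - ursubmx B.

(* The default value 0 only matters when the equation has no solution. *)
Definition sylvester_sol A Theta : 'M[R]_(m, k) :=
  xget 0 [set Z | sylvester A Theta Z].

Definition newton_step A Theta : mat :=
  let Z := sylvester_sol A Theta in
  (Theta^T *m qr_Q (block_mx 1%:M Z (- Z^T) 1%:M))^T.

Definition theta_seq A Theta0 (j : nat) : mat := iter j (newton_step A) Theta0.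

Definition P_seq A Theta0 (j : nat) : mat := proj_of (theta_seq A Theta0 j).

(* s lists the eigenvalues of A with multiplicity, largest first.  When the
   m-th and (m+1)-st eigenvalues coincide the sum of eigenspaces has dimension
   greater than m and no P qualifies.  Row and column eigenspaces agree since A
   is symmetric. *)
Definition dominant_projector A P : Prop :=
  Gr P /\
  exists s : seq R,
    [/\ sorted (fun x y => y <= x) s,
        char_poly A = \prod_(a <- s) ('X - a%:P) &
        (P :=: \sum_(a <- take m s) eigenspace A a)%MS].

Definition converges_locally_quadratically A (Pstar : mat) : Prop :=
  exists (V : set mat) (C : R),
    [/\ V `<=` Gr, within Gr (nbhs Pstar) V &
        forall Theta0, SO Theta0 -> V (proj_of Theta0) ->
        [/\ forall j, exists! Z, sylvester A (theta_seq A Theta0 j) Z,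
            P_seq A Theta0 @ \oo --> Pstar &
            forall j, `|P_seq A Theta0 j.+1 - Pstar|
                      <= C * `|P_seq A Theta0 j - Pstar| ^+ 2]].

End Algorithm.

(* Main.v *)
Require Import Defs.
From mathcomp Require Import all_boot all_order all_algebra.
From mathcomp Require Import all_classical all_reals all_analysis.
From mathcomp Require Import perm measurable_realfun complex spectral ring lra.

(** Write [E = diag (1_m, 0)], [Pi = Theta P* Theta^T], [B = Theta A Theta^T] and
    [H = E - Pi], so that [eps = |H|] is the Frobenius distance from the iterate
    to [P*].  Since [B] commutes with [Pi], [E B - B E = H B - B H], whose upper
    right block gives both [|B12| = O(eps)] and
    [L H12 = - B12 + H11 B12 - B12 H22] for the Sylvester operator
    [L Z = B11 Z - Z B22].  A gap between the m-th and (m+1)-st eigenvalues makes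
    [L] boundedly invertible near [P*], so the Newton direction satisfies
    [|H12 - Z| = O(eps^2)].  The new projector [Pi'] satisfies [Pi' M = M E] with
    [M = 1 + K], [K] skew; right multiplication by [M] does not decrease the norm,
    and [|Pi' - Pi|^2 = 2 |(1 - Pi) Pi'|^2], hence [|Pi' - Pi| = O(eps^2)].

    The gap exists for almost all [A]: with [v = (1, ..., 1)], the determinant of
    the rows [v, v A, ..., v A^(n-1)] is a nonzero polynomial in the entries of
    [A]; diagonalizing [A], it has the Vandermonde determinant of the eigenvalues
    as a factor, so it vanishes as soon as two eigenvalues coincide. *)

Set Implicit Arguments.
Unset Strict Implicit.
Unset Printing Implicit Defensive.

Import Order.TTheory GRing.Theory Num.Theory.
Import numFieldNormedType.Exports.
Local Open Scope classical_set_scope.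
Local Open Scope ring_scope.

(** * Frobenius norm *)

Section Frobenius.
Context (R : rcfType).

Definition mxdot p q (A B : 'M[R]_(p, q)) : R := \tr (A *m B^T).
Definition frob p q (A : 'M[R]_(p, q)) : R := Num.sqrt (mxdot A A).

Lemma mxdotE p q (A B : 'M[R]_(p, q)) :
  mxdot A B = \sum_i \sum_j A i j * B i j.
Proof.
by apply: eq_bigr => i _; rewrite mxE; apply: eq_bigr => j _; rewrite mxE.
Qed.

Lemma mxdotC p q (A B : 'M[R]_(p, q)) : mxdot A B = mxdot B A.
Proof. by rewrite /mxdot -mxtrace_tr trmx_mul trmxK. Qed.

Lemma mxdotDl p q (A B C : 'M[R]_(p, q)) :
  mxdot (A + B) C = mxdot A C + mxdot B C.
Proof. by rewrite /mxdot mulmxDl mxtraceD. Qed.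

Lemma mxdot0l p q (A : 'M[R]_(p, q)) : mxdot 0 A = 0.
Proof. by rewrite /mxdot mul0mx mxtrace0. Qed.

Lemma mxdotNl p q (A B : 'M[R]_(p, q)) : mxdot (- A) B = - mxdot A B.
Proof. by rewrite /mxdot mulNmx raddfN. Qed.

Lemma mxdotZl p q (x : R) (A B : 'M[R]_(p, q)) :
  mxdot (x *: A) B = x * mxdot A B.
Proof. by rewrite /mxdot -scalemxAl mxtraceZ. Qed.

Lemma mxdotBl p q (A B C : 'M[R]_(p, q)) :
  mxdot (A - B) C = mxdot A C - mxdot B C.
Proof. by rewrite mxdotDl mxdotNl. Qed.

Lemma mxdot_tr p q (A B : 'M[R]_(p, q)) : mxdot A^T B^T = mxdot A B.
Proof. by rewrite /mxdot trmxK mxtrace_mulC -mxtrace_tr trmx_mul trmxK. Qed.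

Lemma mxdot_ge0 p q (A : 'M[R]_(p, q)) : 0 <= mxdot A A.
Proof.
by rewrite mxdotE; do 2!apply: sumr_ge0 => ? _; rewrite -expr2 sqr_ge0.
Qed.

Lemma mxdot_eq0 p q (A : 'M[R]_(p, q)) : mxdot A A = 0 -> A = 0.
Proof.
rewrite mxdotE => A0; apply/matrixP => i j; rewrite mxE.
have sq_ge0 (x : R) : 0 <= x * x by rewrite -expr2 sqr_ge0.
have /psumr_eq0P/(_ A0 i isT) Ai0 :
    forall i', true -> 0 <= \sum_j' A i' j' * A i' j'.
  by move=> i' _; exact: sumr_ge0.
have /psumr_eq0P/(_ Ai0 j isT) : forall j', true -> 0 <= A i j' * A i j' by [].
by move/eqP; rewrite mulf_eq0 orbb => /eqP.
Qed.

Lemma frob_ge0 p q (A : 'M[R]_(p, q)) : 0 <= frob A.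
Proof. exact: sqrtr_ge0. Qed.

Lemma frob_sqr p q (A : 'M[R]_(p, q)) : frob A ^+ 2 = mxdot A A.
Proof. by rewrite sqr_sqrtr ?mxdot_ge0. Qed.

Lemma frob_eq0 p q (A : 'M[R]_(p, q)) : frob A <= 0 -> A = 0.
Proof.
move=> A0; apply: mxdot_eq0; rewrite -frob_sqr.
have -> : frob A = 0 by apply/eqP; rewrite eq_le A0 frob_ge0.
by rewrite expr0n.
Qed.

Lemma frob_tr p q (A : 'M[R]_(p, q)) : frob A^T = frob A.
Proof. by rewrite /frob mxdot_tr. Qed.

Lemma frobN p q (A : 'M[R]_(p, q)) : frob (- A) = frob A.
Proof. by rewrite /frob mxdotNl mxdotC mxdotNl opprK. Qed.

Lemma frob_le_sqr p q p' q' (A : 'M[R]_(p, q)) (B : 'M[R]_(p', q')) :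
  mxdot A A <= mxdot B B -> frob A <= frob B.
Proof. by move=> AB; rewrite ler_sqrt ?mxdot_ge0. Qed.

(** Cauchy-Schwarz: the squared norm of [mxdot A A *: B - mxdot A B *: A] is nonnegative and has
    [mxdot A A] as a factor, which is divided out when it is positive. *)
Lemma mxdot_CS p q (A B : 'M[R]_(p, q)) :
  mxdot A B ^+ 2 <= mxdot A A * mxdot B B.
Proof.
have [A0|A0] := eqVneq (mxdot A A) 0.
  by rewrite A0 (mxdot_eq0 A0) /mxdot mul0mx mxtrace0 expr0n mul0r.
have Apos : 0 < mxdot A A by rewrite lt_def A0 mxdot_ge0.
have := mxdot_ge0 (mxdot A A *: B - mxdot A B *: A).
rewrite mxdotBl !mxdotZl !(mxdotC _ (_ - _)) !mxdotBl !mxdotZl (mxdotC B A).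
move: (mxdot A A) (mxdot A B) (mxdot B B) Apos => a c b a0.
have -> : a * (a * b - c * c) - c * (a * c - c * a) = a * (a * b - c ^+ 2).
  by ring.
by rewrite pmulr_rge0// subr_ge0.
Qed.

Lemma mxdot_le p q (A B : 'M[R]_(p, q)) : mxdot A B <= frob A * frob B.
Proof.
rewrite -sqrtrM ?mxdot_ge0// (le_trans (ler_norm _))// -sqrtr_sqr.
by rewrite ler_sqrt ?mxdot_CS// mulr_ge0// mxdot_ge0.
Qed.

Lemma frobD p q (A B : 'M[R]_(p, q)) : frob (A + B) <= frob A + frob B.
Proof.
rewrite -(ler_sqr (frob_ge0 _)) ?nnegrE ?addr_ge0 ?frob_ge0// frob_sqr.
rewrite mxdotDl !(mxdotC _ (_ + _)) !mxdotDl (mxdotC B A) sqrrD !frob_sqr.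
by have := mxdot_le A B; lra.
Qed.

Lemma frobB p q (A B : 'M[R]_(p, q)) : frob (A - B) <= frob A + frob B.
Proof. by rewrite -(frobN B) frobD. Qed.

(** Entry [(i, j)] of the product is the inner product of row [i] of [A] and column [j] of [B], so
    Cauchy-Schwarz bounds its square; summing over [i] and [j] gives the claim. *)
Lemma frobM p q r (A : 'M[R]_(p, q)) (B : 'M[R]_(q, r)) :
  frob (A *m B) <= frob A * frob B.
Proof.
rewrite -sqrtrM ?mxdot_ge0// ler_sqrt ?mulr_ge0 ?mxdot_ge0//.
rewrite -(mxdot_tr B) !mxdotE mulr_suml; apply: ler_sum => i _.
rewrite mulr_sumr; apply: ler_sum => j _.
have := mxdot_CS (row i A) (row j B^T).
rewrite !mxdotE !big_ord1.
under [X in X ^+ 2]eq_bigr do rewrite !mxE.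
under [X in _ <= X * _]eq_bigr do rewrite !mxE.
under [X in _ <= _ * X]eq_bigr do rewrite mxE.
by rewrite !mxE -expr2.
Qed.

Lemma frob_orthl n p (Q : 'M[R]_n) (A : 'M[R]_(n, p)) :
  Q^T *m Q = 1%:M -> frob (Q *m A) = frob A.
Proof.
move=> QQ; rewrite /frob -(mxdot_tr (_ *m _)) /mxdot trmxK trmx_mul.
by rewrite -mulmxA (mulmxA Q^T) QQ mul1mx mxtrace_mulC.
Qed.

Lemma frob_orthr n p (Q : 'M[R]_n) (A : 'M[R]_(p, n)) :
  Q *m Q^T = 1%:M -> frob (A *m Q) = frob A.
Proof. by move=> QQ; rewrite -frob_tr trmx_mul frob_orthl ?trmxK ?frob_tr. Qed.

(** Pythagoras for the orthogonal decomposition of [A] into [P *m A] and [(1%:M - P) *m A]. *)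
Lemma frob_projl n p (P : 'M[R]_n) (A : 'M[R]_(n, p)) :
  P^T = P -> P *m P = P -> frob (P *m A) <= frob A.
Proof.
move=> PT PP; apply: frob_le_sqr.
have -> : mxdot A A = mxdot (P *m A) (P *m A)
    + mxdot ((1%:M - P) *m A) ((1%:M - P) *m A).
  rewrite -(mxdot_tr A) -(mxdot_tr (P *m A)) -(mxdot_tr (_ *m A)) /mxdot !trmxK.
  rewrite !trmx_mul linearB /= trmx1 PT -!mulmxA (mulmxA P P) PP.
  rewrite (mulmxA (1%:M - P) _ A) mulmxBl mul1mx mulmxBr mulmx1 PP subrr subr0.
  by rewrite mulmxBl mul1mx mulmxBr raddfB /= addrC subrK.
by rewrite lerDl mxdot_ge0.
Qed.

Lemma mxdot_col p1 p2 q (A A' : 'M[R]_(p1, q)) (B B' : 'M[R]_(p2, q)) :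
  mxdot (col_mx A B) (col_mx A' B') = mxdot A A' + mxdot B B'.
Proof. by rewrite /mxdot tr_col_mx mul_col_row mxtrace_block. Qed.

Lemma mxdot_row p q1 q2 (A A' : 'M[R]_(p, q1)) (B B' : 'M[R]_(p, q2)) :
  mxdot (row_mx A B) (row_mx A' B') = mxdot A A' + mxdot B B'.
Proof. by rewrite -mxdot_tr !tr_row_mx mxdot_col !mxdot_tr. Qed.

Lemma frob_usub p1 p2 q (A : 'M[R]_(p1 + p2, q)) : frob (usubmx A) <= frob A.
Proof.
apply: frob_le_sqr; rewrite -[in leRHS](vsubmxK A) mxdot_col.
by rewrite lerDl mxdot_ge0.
Qed.

Lemma frob_dsub p1 p2 q (A : 'M[R]_(p1 + p2, q)) : frob (dsubmx A) <= frob A.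
Proof.
apply: frob_le_sqr; rewrite -[in leRHS](vsubmxK A) mxdot_col.
by rewrite lerDr mxdot_ge0.
Qed.

Lemma frob_lsub p q1 q2 (A : 'M[R]_(p, q1 + q2)) : frob (lsubmx A) <= frob A.
Proof. by rewrite -frob_tr trmx_lsub -(frob_tr A) frob_usub. Qed.

Lemma frob_rsub p q1 q2 (A : 'M[R]_(p, q1 + q2)) : frob (rsubmx A) <= frob A.
Proof. by rewrite -frob_tr trmx_rsub -(frob_tr A) frob_dsub. Qed.

Lemma frob_col_mx p1 p2 q (A : 'M[R]_(p1, q)) (B : 'M[R]_(p2, q)) :
  frob (col_mx A B) <= frob A + frob B.
Proof.
rewrite -(ler_sqr (frob_ge0 _)) ?nnegrE ?addr_ge0 ?frob_ge0// frob_sqr mxdot_col.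
rewrite sqrrD !frob_sqr; have := mulr_ge0 (frob_ge0 A) (frob_ge0 B); lra.
Qed.

Lemma frob_col_mx0 p1 p2 q (A : 'M[R]_(p1, q)) : 
  frob (col_mx A 0 : 'M[R]_(p1 + p2, q)) = frob A.
Proof. by rewrite /frob mxdot_col mxdot0l addr0. Qed.

Lemma frob_col_0mx p1 p2 q (A : 'M[R]_(p2, q)) : 
  frob (col_mx 0 A : 'M[R]_(p1 + p2, q)) = frob A.
Proof. by rewrite /frob mxdot_col mxdot0l add0r. Qed.

Lemma frob_row_mx0 p q1 q2 (A : 'M[R]_(p, q1)) :
  frob (row_mx A 0 : 'M[R]_(p, q1 + q2)) = frob A.
Proof. by rewrite /frob mxdot_row mxdot0l addr0. Qed.

(* Both sides equal [2 * (\tr P - \tr (P *m P'))]. *)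
Lemma frob_proj_diff n (P P' : 'M[R]_n) :
  P^T = P -> P *m P = P -> P'^T = P' -> P' *m P' = P' -> \tr P = \tr P' ->
  frob (P' - P) ^+ 2 = 2 * frob ((1%:M - P) *m P') ^+ 2.
Proof.
move=> PT PP P'T P'P' PP'; rewrite !frob_sqr /mxdot trmx_mul.
have -> : (P' - P)^T = P' - P by rewrite linearB /= PT P'T.
have -> : (1%:M - P)^T = 1%:M - P by rewrite linearB /= PT trmx1.
rewrite P'T mulmxA -(mulmxA _ P' P') P'P' [in RHS]mxtrace_mulC mulmxA.
have -> : (1%:M - P) *m (1%:M - P) = 1%:M - P.
  by rewrite mulmxBl mul1mx mulmxBr mulmx1 PP subrr subr0.
rewrite !mulmxBl !mulmxBr mul1mx PP P'P' !raddfB /= (mxtrace_mulC P' P) PP'.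
ring.
Qed.

End Frobenius.

(** * One step of the algorithm *)

Section NewtonStep.
Context (R : rcfType) (m k : nat).
Local Notation n := (m + k)%N.
Local Notation E := (block_mx 1%:M 0 0 0 : 'M[R]_(m + k)).

Lemma tr_corner : E^T = E.
Proof. by rewrite tr_block_mx !trmx0 trmx1. Qed.

Lemma corner_idem : E *m E = E.
Proof. by rewrite mulmx_block !mulmx0 !mul0mx !mulmx1 !addr0. Qed.

Lemma mxtrace_corner : \tr E = m%:R.
Proof. by rewrite mxtrace_block mxtrace1 mxtrace0 addr0. Qed.

(* [a] and [b] play the role of the m-th and (m+1)-st eigenvalues: [B] is at
   least [a] on the range of [P] and at most [b] on its kernel. *)
Definition spectral_gap (a b c : R) (B P : 'M[R]_n) : Prop :=
  forall p (U : 'M[R]_(n, p)),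
    a * frob U ^+ 2 - c * frob ((1%:M - P) *m U) ^+ 2 <= mxdot U (B *m U) /\
    mxdot U (B *m U) <= b * frob U ^+ 2 + c * frob (P *m U) ^+ 2.

Variables (a b c : R) (B P : 'M[R]_n).
Hypotheses (c_ge0 : 0 <= c) (BT : B^T = B) (PT : P^T = P) (PP : P *m P = P)
  (trP : \tr P = m%:R) (BP : B *m P = P *m B) (gap : spectral_gap a b c B P).

Local Notation H := (E - P).
Local Notation eps := (frob H).
Local Notation B11 := (ulsubmx B).
Local Notation B12 := (ursubmx B).
Local Notation B22 := (drsubmx B).
Local Notation syl Z := (B11 *m Z - Z *m B22).

(** The gap is tested on [Z] padded by zeros. Such a [U] is fixed by [E], so it is nearly fixed by
    [P], and the penalty term of the gap is only of order [eps ^+ 2]. *)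
Lemma mxdot_upper (Z : 'M[R]_(m, k)) :
  (a - c * eps ^+ 2) * frob Z ^+ 2 <= mxdot Z (B11 *m Z).
Proof.
pose U : 'M[R]_(n, k) := col_mx Z 0.
have [+ _] := gap U; rewrite frob_col_mx0.
have -> : B *m U = col_mx (B11 *m Z) (dlsubmx B *m Z).
  by rewrite -{1}(submxK B) mul_block_col !mulmx0 !addr0.
rewrite mxdot_col mxdot0l addr0; apply: le_trans.
have EU : E *m U = U by rewrite mul_block_col !mulmx0 !mul0mx mul1mx !addr0.
(* [H *m U = U - P *m U], and [1%:M - P] kills the second term. *)
have -> : (1%:M - P) *m U = (1%:M - P) *m (H *m U).
  have -> : H *m U = U - P *m U by rewrite mulmxBl EU.
  rewrite mulmxBr (mulmxA (1%:M - P) P) [(1%:M - P) *m P]mulmxBl PP mul1mx.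
  by rewrite subrr mul0mx subr0.
have P1 : frob ((1%:M - P) *m (H *m U)) <= frob (H *m U).
  apply: frob_projl; first by rewrite linearB /= trmx1 PT.
  by rewrite mulmxBl mul1mx mulmxBr mulmx1 PP subrr subr0.
have le_eps : frob ((1%:M - P) *m (H *m U)) <= eps * frob Z.
  by rewrite (le_trans P1)// (le_trans (frobM _ _))// frob_col_mx0.
rewrite mulrBl lerB// -mulrA ler_wpM2l// -exprMn.
by rewrite ler_sqr ?nnegrE ?mulr_ge0 ?frob_ge0.
Qed.

(** Dual to the previous bound: [U] now lies in the kernel of [E]. Since [B22] acts on the right of
    [Z], the test matrix contains [Z^T]. *)
Lemma mxdot_lower (Z : 'M[R]_(m, k)) :
  mxdot Z (Z *m B22) <= (b + c * eps ^+ 2) * frob Z ^+ 2.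
Proof.
pose U : 'M[R]_(n, m) := col_mx 0 Z^T.
have [_] := gap U; rewrite frob_col_0mx frob_tr.
have -> : B *m U = col_mx (B12 *m Z^T) (B22 *m Z^T).
  by rewrite -{1}(submxK B) mul_block_col !mulmx0 !add0r.
have B22T : B22^T = B22 by rewrite trmx_drsub BT.
rewrite mxdot_col mxdot0l add0r -[B22 in X in X -> _]B22T.
rewrite -trmx_mul mxdot_tr => /le_trans; apply.
have EU : E *m U = 0 by rewrite mul_block_col !mulmx0 !mul0mx !addr0 col_mx0.
have -> : P *m U = - (P *m (H *m U)).
  have -> : H *m U = - (P *m U) by rewrite mulmxBl EU sub0r.
  by rewrite mulmxN opprK mulmxA PP.
have P1 : frob (P *m (H *m U)) <= frob (H *m U) by exact: frob_projl.
have le_eps : frob (P *m (H *m U)) <= eps * frob Z.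
  by rewrite (le_trans P1)// (le_trans (frobM _ _))// frob_col_0mx frob_tr.
rewrite mulrDl lerD2l -mulrA ler_wpM2l// frobN -exprMn.
by rewrite ler_sqr ?nnegrE ?mulr_ge0 ?frob_ge0.
Qed.

Hypotheses (ab : b < a) (eps_small : 4 * c * eps ^+ 2 <= a - b).

(** Pairing [syl Z] with [Z] gives at least [(a - b - 2 * c * eps ^+ 2) * frob Z ^+ 2], which by
    [eps_small] is at least half of [(a - b) * frob Z ^+ 2]; Cauchy-Schwarz bounds the pairing from
    above. *)
Lemma sylvester_lower_bound (Z : 'M[R]_(m, k)) :
  frob Z <= 2 / (a - b) * frob (syl Z).
Proof.
have ab0 : 0 < a - b by rewrite subr_gt0.
rewrite mulrAC ler_pdivlMr// mulrC.
have [->|Z0] := eqVneq (frob Z) 0; first by rewrite mulr0 mulr_ge0 ?frob_ge0.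
have Zpos : 0 < frob Z by rewrite lt_def Z0 frob_ge0.
rewrite -(ler_pM2r Zpos) -mulrA -expr2 -mulrA.
have := mxdot_le (syl Z) Z; rewrite mxdotBl ![mxdot _ Z]mxdotC.
have := mxdot_upper Z; have := mxdot_lower Z.
move: (mxdot _ _) (mxdot _ _) (frob (syl Z)) => x y z h1 h2 h3.
have h4 : 0 <= (a - b - 4 * c * eps ^+ 2) * frob Z ^+ 2.
  by rewrite mulr_ge0 ?sqr_ge0// subr_ge0.
lra.
Qed.

(** The lower bound makes the Sylvester operator injective, hence bijective in finite dimension; [G]
    is its matrix on vectorized arguments. *)
Lemma sylvester_unique (Y : 'M[R]_(m, k)) : exists! Z, syl Z = Y.
Proof.
pose G := lin_mx (mulmx B11) - lin_mx (mulmxr B22) : 'M[R]_(m * k).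
have GE (Z : 'M[R]_(m, k)) : mxvec Z *m G = mxvec (syl Z).
  by rewrite mulmxBr !mul_vec_lin linearB.
have Gfree : row_free G.
  apply: inj_row_free => v; rewrite -(vec_mxK v) GE => /(congr1 vec_mx).
  rewrite mxvecK linear0 => v0; rewrite (@frob_eq0 _ _ _ (vec_mx v)) ?linear0//.
  by rewrite (le_trans (sylvester_lower_bound _))// v0 /frob mxdot0l sqrtr0 mulr0.
have Gu : G \in unitmx by rewrite -row_free_unit.
exists (vec_mx (mxvec Y *m invmx G)); split.
  by apply: (can_inj mxvecK); rewrite -GE vec_mxK mulmxKV.
by move=> Z ZY; rewrite -ZY -GE mulmxK// mxvecK.
Qed.

Lemma frob_ursub (A : 'M[R]_n) : frob (ursubmx A) <= frob A.
Proof. exact: le_trans (frob_rsub _) (frob_usub _). Qed.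

Lemma comm_corner_ursub (A : 'M[R]_n) : ursubmx (E *m A - A *m E) = ursubmx A.
Proof.
rewrite -{1 2}(submxK A) !mulmx_block !mul1mx !mul0mx !mulmx0 !mulmx1 !addr0.
by rewrite opp_block_mx add_block_mx block_mxKur subr0.
Qed.

Lemma comm_diff : E *m B - B *m E = H *m B - B *m H.
Proof. by rewrite mulmxBl mulmxBr BP opprB addrA subrK. Qed.

Lemma frob_ursub_le : frob B12 <= 2 * frob B * eps.
Proof.
rewrite -comm_corner_ursub comm_diff (le_trans (frob_ursub _))//.
rewrite (le_trans (frobB _ _))//.
have := frobM H B; have := frobM B H; lra.
Qed.

Lemma frob_ulsub (A : 'M[R]_n) : frob (ulsubmx A) <= frob A.
Proof. exact: le_trans (frob_lsub _) (frob_usub _). Qed.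

Lemma frob_drsub (A : 'M[R]_n) : frob (drsubmx A) <= frob A.
Proof. exact: le_trans (frob_rsub _) (frob_dsub _). Qed.

(** The block [H12] solves the equation of the algorithm up to two products of a block of [H] with
    [B12]. As [B12] is itself O(eps), these are O(eps^2). *)
Lemma sylvester_diff :
  syl (ursubmx H) = - B12 + (ulsubmx H *m B12 - B12 *m drsubmx H).
Proof.
have := congr1 ursubmx comm_diff; rewrite comm_corner_ursub.
rewrite -[X in X *m B](submxK H) -[X in B *m X](submxK H).
rewrite -{2 3}(submxK B) !mulmx_block opp_block_mx add_block_mx block_mxKur.
move=> {1}->; rewrite !opprD !opprK.
set x1 := ulsubmx H *m _; set x2 := ursubmx H *m _.
set x3 := B11 *m _; set x4 := B12 *m _.
by apply/matrixP => i j; rewrite !mxE; ring.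
Qed.

(** Idempotence of [E] and [P] gives [H *m H = E *m H + H *m E - H], whose upper left block is that
    of [H]. Hence this block is of second order in [eps]. *)
Lemma ulsub_diff : ulsubmx H = ulsubmx (H *m H).
Proof.
have -> : H *m H = E *m H + H *m E - H.
  rewrite [E *m (E - P)]mulmxBr corner_idem.
  rewrite mulmxBl !mulmxBr !mulmxBl corner_idem PP.
  by apply/matrixP => i j; rewrite !mxE; ring.
rewrite -{2 3 4}(submxK H) !mulmx_block !mul1mx !mul0mx !mulmx0 !mulmx1 !addr0.
by rewrite opp_block_mx !add_block_mx block_mxKul addrK.
Qed.

Variable Z : 'M[R]_(m, k).
Hypothesis ZE : syl Z = - B12.
Local Notation M := (block_mx 1%:M Z (- Z^T) 1%:M : 'M[R]_n).

(** In the expansion of [|Y + Y K|^2] the cross term vanishes, because skewness of [K] makes it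
    equal to its own negative. *)
Lemma frob_mul_skew p (Y : 'M[R]_(p, n)) : frob Y <= frob (Y *m M).
Proof.
pose K : 'M[R]_n := block_mx 0 Z (- Z^T) 0.
have KT : K^T = - K.
  by rewrite tr_block_mx opp_block_mx linearN /= trmxK !trmx0 !oppr0 opprK.
have -> : M = 1%:M + K by rewrite scalar_mx_block add_block_mx !addr0 !add0r.
apply: frob_le_sqr; have -> : mxdot (Y *m (1%:M + K)) (Y *m (1%:M + K)) =
    mxdot Y Y + mxdot (Y *m K) (Y *m K).
  rewrite mulmxDr mulmx1 mxdotDl !(mxdotC _ (_ + _)) !mxdotDl (mxdotC (_ *m K) Y).
  suff -> : mxdot Y (Y *m K) = 0 by rewrite addr0 add0r.
  have : mxdot Y (Y *m K) = - mxdot Y (Y *m K).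
    rewrite {1}/mxdot trmx_mul KT mulNmx mulmxN raddfN /= mulmxA.
    by rewrite -/(mxdot (Y *m K) Y) mxdotC.
  by lra.
by rewrite lerDl mxdot_ge0.
Qed.

(** The hypothesis [P' *m M = M *m E] says that [P'] fixes the first [m] columns of [M] and kills
    the others, so [P'] projects onto the span of the columns of [(1; - Z^T)]. *)
Lemma newton_step_bound (P' : 'M[R]_n) :
  P'^T = P' -> P' *m P' = P' -> \tr P' = m%:R -> P' *m M = M *m E ->
  frob (P' - P) <= 2 * (1 + 16 * frob B / (a - b)) * eps ^+ 2.
Proof.
move=> P'T P'P' trP' P'M.
have ab0 : 0 < a - b by rewrite subr_gt0.
(* [z] bounds [frob Z / eps]: it is the inverse bound [2 / (a - b)] of the Sylvester operator times
   the factor [2 * frob B] bounding [B12]. *)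
pose z := 4 * frob B / (a - b).
have z0 : 0 <= z by rewrite /z divr_ge0 ?mulr_ge0 ?frob_ge0// ltW.
have e0 : 0 <= eps by exact: frob_ge0.
have B12le := frob_ursub_le.
have g0 : 0 <= 2 / (a - b) by rewrite divr_ge0// ltW.
have Zle : frob Z <= z * eps.
  apply: le_trans (sylvester_lower_bound _) _; rewrite ZE frobN.
  apply: le_trans (ler_wpM2l g0 B12le) _.
  by rewrite le_eqVlt; apply/orP; left; apply/eqP; rewrite /z; ring.
(* Subtracting the equation for [Z] from the one for [H12] cancels [B12] and leaves only the
   quadratic terms. *)
have HZle : frob (ursubmx H - Z) <= 2 * z * eps ^+ 2.
  apply: le_trans (sylvester_lower_bound _) _.
  have -> : syl (ursubmx H - Z) = ulsubmx H *m B12 - B12 *m drsubmx H.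
    rewrite mulmxBr mulmxBl opprD addrACA -[X in _ + X]opprD ZE sylvester_diff.
    by rewrite addrAC subrr add0r.
  have le1 : frob (ulsubmx H *m B12 - B12 *m drsubmx H) <=
      eps * (2 * frob B * eps) + (2 * frob B * eps) * eps.
    apply: le_trans (frobB _ _) _; apply: lerD.
      by apply: le_trans (frobM _ _) _; rewrite ler_pM ?frob_ge0 ?frob_ulsub.
    by apply: le_trans (frobM _ _) _; rewrite ler_pM ?frob_ge0 ?frob_drsub.
  apply: le_trans (ler_wpM2l g0 le1) _.
  by rewrite le_eqVlt; apply/orP; left; apply/eqP; rewrite /z; ring.
(* By [frob_mul_skew] it suffices to bound [(1%:M - P) *m M *m E], that is, the first block column
   of [(1%:M - P) *m M], where [1%:M - P] is [1%:M - E + H]. The top block contributes [1 + z] and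
   the bottom block [2 * z + z]. *)
have ineq : frob ((1%:M - P) *m P') <= (1 + 4 * z) * eps ^+ 2.
  apply: le_trans (frob_mul_skew _) _; rewrite -mulmxA P'M.
  have -> : 1%:M - P = block_mx (ulsubmx H) (ursubmx H) (dlsubmx H)
      (1%:M + drsubmx H) :> 'M[R]_n.
    have -> : 1%:M - P = block_mx 0 0 0 1%:M + H :> 'M[R]_n.
      rewrite scalar_mx_block addrA add_block_mx.
      by rewrite !addr0 !add0r.
    by rewrite -{1}(submxK H) add_block_mx !add0r.
  rewrite !mulmx_block !(mulmx1, mulmx0, addr0).
  rewrite block_mxEh col_mx0 frob_row_mx0 (le_trans (frob_col_mx _ _))//.
  have top : frob (ulsubmx H + ursubmx H *m - Z^T) <= eps ^+ 2 + eps * (z * eps).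
    apply: le_trans (frobD _ _) _; apply: lerD.
      by rewrite ulsub_diff (le_trans (frob_ulsub _))// expr2 frobM.
    apply: le_trans (frobM _ _) _; rewrite frobN frob_tr.
    by rewrite ler_pM ?frob_ge0 ?frob_ursub.
  have bot : frob (dlsubmx H + (1%:M + drsubmx H) *m - Z^T) <=
      2 * z * eps ^+ 2 + eps * (z * eps).
    have -> : dlsubmx H + (1%:M + drsubmx H) *m - Z^T =
        (ursubmx H - Z)^T - drsubmx H *m Z^T.
      rewrite linearB /= trmx_ursub linearB /= tr_corner PT mulmxDl mul1mx mulmxN.
      by rewrite addrA.
    apply: le_trans (frobB _ _) _; rewrite frob_tr lerD//.
    apply: le_trans (frobM _ _) _; rewrite frob_tr.
    by rewrite ler_pM ?frob_ge0 ?frob_drsub.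
  by apply: le_trans (lerD top bot) _; lra.
have rhs0 : 0 <= 2 * (1 + 16 * frob B / (a - b)) * eps ^+ 2.
  have -> : 16 * frob B / (a - b) = 4 * z by rewrite /z; ring.
  by rewrite mulr_ge0 ?sqr_ge0// mulr_ge0// addr_ge0// mulr_ge0.
(* The identity for projectors yields the factor [sqrt 2], here enlarged to [2]. *)
rewrite -(ler_sqr (frob_ge0 _) rhs0) (@frob_proj_diff _ _ P P') ?trP ?trP'//.
have -> : 2 * (1 + 16 * frob B / (a - b)) * eps ^+ 2 =
    2 * ((1 + 4 * z) * eps ^+ 2) by rewrite /z; ring.
have : frob ((1%:M - P) *m P') ^+ 2 <= ((1 + 4 * z) * eps ^+ 2) ^+ 2.
  rewrite ler_sqr ?nnegrE ?frob_ge0// mulr_ge0 ?sqr_ge0//.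
  by rewrite addr_ge0// mulr_ge0.
rewrite (exprMn _ 2).
by have := sqr_ge0 ((1 + 4 * z) * eps ^+ 2); lra.
Qed.

End NewtonStep.

(** * QR factorization *)

Section QR.
Context (R : realType).

Lemma orthogonal_mxC n (Q : 'M[R]_n) : orthogonal_mx Q -> Q *m Q^T = 1%:M.
Proof. exact: mulmx1C. Qed.

Lemma orthogonal_tr n (Q : 'M[R]_n) : orthogonal_mx Q -> orthogonal_mx Q^T.
Proof. by move=> /orthogonal_mxC; rewrite /orthogonal_mx trmxK. Qed.

Lemma orthogonal_mul n (P Q : 'M[R]_n) :
  orthogonal_mx P -> orthogonal_mx Q -> orthogonal_mx (P *m Q).
Proof.
move=> oP oQ; rewrite /orthogonal_mx trmx_mul mulmxA -(mulmxA Q^T) oP.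
by rewrite mulmx1.
Qed.

Lemma upper_triangular_unit n (T : 'M[R]_n) :
  upper_triangular_pos T -> T \in unitmx.
Proof.
move=> [T0 Tpos]; rewrite -unitmx_tr unitmxE det_trig; last first.
  by apply/is_trig_mxP => i j ij; rewrite mxE T0.
by rewrite unitfE; apply/prodf_neq0 => i _; rewrite mxE gt_eqF.
Qed.

(** Induction on the size: the Schur complement of the top left entry is again positive definite,
    and its factor fills the lower right corner. *)
Lemma cholesky n (S : 'M[R]_n) : S^T = S ->
  (forall v : 'rV_n, v != 0 -> 0 < (v *m S *m v^T) 0 0) ->
  exists2 T, upper_triangular_pos T & T^T *m T = S.
Proof.
elim: n S => [|n IH] S ST Spos.
  by exists 0; [split => -[]|apply/matrixP => -[]].
rewrite -[n.+1]/(1 + n)%N in S ST Spos *.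
pose s := S 0 0; pose w : 'rV[R]_n := ursubmx S.
have SE : S = block_mx s%:M w w^T (drsubmx S).
  rewrite -{1}(submxK S); congr block_mx; last by rewrite trmx_ursub ST.
  rewrite [LHS]mx11_scalar; congr (_%:M); rewrite !mxE /s.
  by congr (S _ _); exact: val_inj.
have quad (x : R) (u : 'rV[R]_n) :
    (row_mx x%:M u *m S *m (row_mx x%:M u)^T) 0 0 =
    s * x ^+ 2 + 2 * x * (u *m w^T) 0 0 + (u *m drsubmx S *m u^T) 0 0.
  have uw : w *m u^T = u *m w^T.
    rewrite -[LHS]trmxK trmx_mul trmxK.
    by apply/matrixP => i j; rewrite mxE !ord1.
  rewrite {1}SE mul_row_block tr_row_mx mul_row_col tr_scalar_mx !mulmxDl.
  rewrite !mul_mx_scalar !mul_scalar_mx -scalemxAl uw.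
  move: (u *m w^T) (u *m drsubmx S *m u^T) => W X.
  by rewrite !mxE eqxx mulr1n; ring.
have s0 : 0 < s.
  have := Spos (row_mx 1%:M 0).
  rewrite quad !mul0mx !mxE !mulr0 !addr0 expr1n mulr1; apply.
  apply/eqP => /(congr1 lsubmx); rewrite row_mxKl linear0 => /matrixP/(_ 0 0).
  by rewrite !mxE; apply/eqP; rewrite oner_eq0.
have sq0 : 0 < Num.sqrt s by rewrite sqrtr_gt0.
have sqE : Num.sqrt s * Num.sqrt s = s by rewrite -expr2 sqr_sqrtr// ltW.
have [T' [T'0 T'pos] T'E] : exists2 T', upper_triangular_pos T' &
    T'^T *m T' = drsubmx S - s^-1 *: (w^T *m w).
  apply: IH.
    by rewrite linearB linearZ /= trmx_mul trmxK trmx_drsub ST.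
  (* This first coordinate minimizes the quadratic form for fixed [u], and the minimum is the value
     of the Schur complement at [u]. *)
  move=> u u0; have := Spos (row_mx (- (s^-1 * (u *m w^T) 0 0))%:M u).
  rewrite quad => /(_ _)/lt_le_trans; apply.
    apply/eqP => /(congr1 rsubmx); rewrite row_mxKr linear0; exact/eqP.
  rewrite mulmxBr mulmxBl -scalemxAr -scalemxAl !mulmxA -(mulmxA (_ *m w^T)).
  have -> : (w *m u^T) = (u *m w^T)^T by rewrite trmx_mul trmxK.
  move: (u *m w^T) (u *m drsubmx S *m u^T) => W X.
  rewrite !mxE big_ord1 mxE le_eqVlt; apply/orP; left; apply/eqP.
  by field; rewrite gt_eqF.
exists (block_mx (Num.sqrt s)%:M ((Num.sqrt s)^-1 *: w) 0 T').
  split.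
    move=> i j; case: (split_ordP i) => i' ->; case: (split_ordP j) => j' ->.
    - by rewrite !ord1.
    - by rewrite /= ord1.
    - by rewrite block_mxEdl mxE.
    - by rewrite block_mxEdr /= ltn_add2l => /T'0.
  move=> i; case: (split_ordP i) => i' ->.
    by rewrite block_mxEul ord1 mxE eqxx.
  by rewrite block_mxEdr.
rewrite tr_block_mx mulmx_block [RHS]SE tr_scalar_mx.
rewrite !trmx0 !mul0mx !mulmx0 !addr0.
congr block_mx.
- by rewrite -scalar_mxM sqE.
- by rewrite mul_scalar_mx scalerA divff ?scale1r// gt_eqF.
- by rewrite mul_mx_scalar linearZ /= scalerA divff ?scale1r// gt_eqF.
- rewrite T'E [(_ *: w)^T]linearZ /= -scalemxAl -scalemxAr scalerA -invfM sqE.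
  by rewrite addrC subrK.
Qed.

(** If [T] is the Cholesky factor of [M^T *m M], then [M *m invmx T] is orthogonal. *)
Lemma qr_exists n (M : 'M[R]_n) : M \in unitmx ->
  exists Q, orthogonal_mx Q /\ exists2 T, upper_triangular_pos T & M = Q *m T.
Proof.
move=> Mu; have [||T Tup TE] := @cholesky _ (M^T *m M).
- by rewrite trmx_mul trmxK.
- move=> v v0; rewrite mulmxA -mulmxA -[M in X in _ *m X]trmxK -trmx_mul.
  have -> (X : 'M[R]_1) : X 0 0 = \tr X by rewrite /mxtrace big_ord1.
  rewrite lt_def mxdot_ge0 andbT; apply: contraNneq v0 => /mxdot_eq0.
  move=> /(congr1 (mulmx^~ (invmx M^T))).
  by rewrite mulmxK ?unitmx_tr// mul0mx => ->.
have Tu := upper_triangular_unit Tup.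
exists (M *m invmx T); split; last by exists T; rewrite ?mulmxKV.
rewrite /orthogonal_mx trmx_mul mulmxA -(mulmxA _ M^T) -TE mulmxA.
by rewrite -trmx_mul mulmxV// trmx1 mul1mx mulmxV.
Qed.

Lemma qr_QP n (M : 'M[R]_n) : M \in unitmx ->
  orthogonal_mx (qr_Q M) /\
  exists2 T, upper_triangular_pos T & M = qr_Q M *m T.
Proof. by move=> /qr_exists ex; exact: (xgetPex 1%:M ex). Qed.

(** * The orthogonal factor of the matrix in step (iii) *)

Variables (m k : nat) (Z : 'M[R]_(m, k)).
Local Notation M := (block_mx 1%:M Z (- Z^T) 1%:M : 'M[R]_(m + k)).
Local Notation E := (block_mx 1%:M 0 0 0 : 'M[R]_(m + k)).

Lemma skew_block_unit : M \in unitmx.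
Proof.
rewrite -row_free_unit; apply: inj_row_free => v vM.
apply: frob_eq0; rewrite (le_trans (frob_mul_skew Z v))// vM.
by rewrite /frob mxdot0l sqrtr0.
Qed.

(* The columns of the two block columns of [M] are mutually orthogonal, so the
   triangular factor is block diagonal. *)
Lemma qr_skew_block : qr_Q M *m E *m (qr_Q M)^T *m M = M *m E.
Proof.
have := qr_QP skew_block_unit; move: (qr_Q M) => Q [Qo [T Tup MT]].
have MM : T^T *m T = M^T *m M.
  by rewrite MT trmx_mul mulmxA -(mulmxA _ Q^T) Qo mulmx1.
have T21 : dlsubmx T = 0.
  apply/matrixP => i j; rewrite !mxE; apply: (proj1 Tup) => /=.
  by rewrite (leq_trans (ltn_ord j))// leq_addr.
have T11u : ulsubmx T \in unitmx.
  apply: upper_triangular_unit; split => [i j ij|i]; rewrite !mxE.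
    by apply: (proj1 Tup).
  by apply: (proj2 Tup).
have T12 : ursubmx T = 0.
  have : (ulsubmx T)^T *m ursubmx T = 0.
    have := congr1 ursubmx MM; rewrite -{1 2}(submxK T) T21.
    rewrite !tr_block_mx !mulmx_block !block_mxKur !trmx0 mul0mx addr0 => ->.
    by rewrite trmx1 mul1mx mulmx1 linearN /= trmxK subrr.
  move=> /(congr1 (mulmx (invmx (ulsubmx T)^T))).
  by rewrite mulKmx ?unitmx_tr// mulmx0.
rewrite MT !mulmxA -(mulmxA _ Q^T) Qo mulmx1 -!mulmxA; congr (_ *m _).
rewrite -(submxK T) T12 T21 !mulmx_block.
by rewrite !(mulmx0, mul0mx, mulmx1, mul1mx, addr0).
Qed.

End QR.

(** * Spectral theorem for real symmetric matrices *)

Section Spectral.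
Context (R : realType).

(** Over the complex numbers [A] is hermitian, hence unitarily diagonalizable with real eigenvalues;
    a real root of the complexified characteristic polynomial is a root of the original one. *)
Lemma symmetric_eigenvalue n (A : 'M[R]_n.+1) :
  A^T = A -> exists a, eigenvalue A a.
Proof.
move=> AT; pose C := [the numClosedFieldType of R[i]].
pose Ac : 'M[C]_n.+1 := map_mx (real_complex R) A.
have Ah : Ac \is hermsymmx.
  apply: realsym_hermsym.
    apply/is_hermitianmxP; rewrite expr0 scale1r map_mx_id//.
    by rewrite /Ac map_trmx AT.
  apply/mxOverP => i j; rewrite mxE; by apply/complex_realP; exists (A i j).
have /orthomx_spectralP AE := hermitian_normalmx Ah.
have dR := hermitian_spectral_diag_real Ah.
set M := spectralmx Ac in AE; set d := spectral_diag Ac in AE dR.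
have Mu : M \in unitmx := spectral_unit Ac.
have d0 : eigenvalue Ac (d 0 0).
  apply/eigenvalueP; exists (row 0 M).
    rewrite AE -row_mul !mulmxA mulmxV// mul1mx row_mul row_diag_mx.
    by rewrite -scalemxAl -rowE.
  apply: contraTneq Mu => r0; rewrite -row_free_unit; apply/negP.
  move=> /row_freeP[N MN]; have := congr1 (row 0) MN.
  rewrite row_mul r0 mul0mx => /rowP/(_ 0); rewrite !mxE eqxx => /eqP.
  by rewrite eq_sym oner_eq0.
have [x dx] : exists x : R, d 0 0 = x%:C%C.
  by have /mxOverP/(_ 0 0)/complex_realP := dR.
exists x; rewrite eigenvalue_root_char -(fmorph_root (real_complex R)).
by move: d0; rewrite dx map_char_poly eigenvalue_root_char.
Qed.

(** [H] is the Householder reflection exchanging [v] with the first basis vector [e]. When [v = e]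
    there is no reflection vector, and the identity serves. *)
Lemma orthogonal_extend n (v : 'rV[R]_n.+1) :
  mxdot v v = 1 ->
  exists H : 'M[R]_n.+1, [/\ orthogonal_mx H, H^T = H & row 0 H = v].
Proof.
move=> v1; pose e : 'rV[R]_n.+1 := delta_mx 0 0.
have [ve|ve] := eqVneq v e.
  by exists 1%:M; split; rewrite /orthogonal_mx ?trmx1 ?mul1mx// row1 ve.
have dotE (u w : 'rV[R]_n.+1) : u *m w^T = (mxdot u w)%:M.
  by rewrite [LHS]mx11_scalar /mxdot /mxtrace big_ord1.
pose w := v - e; pose c := mxdot w w.
have c0 : c != 0.
  by apply: contra_neq ve => /mxdot_eq0/eqP; rewrite subr_eq0 => /eqP.
have e1 : mxdot e e = 1.
  by rewrite mxdotE big_ord1 (bigD1 0)//= !mxE !eqxx mulr1 big1 ?addr0// => i i0;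
    rewrite !mxE (negbTE i0) andbF mulr0.
(* Both vectors are unit, so [c = 2 - 2 * mxdot e v]. Hence reflecting [e] adds exactly [w], which
   gives [v]. *)
have ew : mxdot e w = - (c / 2).
  rewrite /c /w (mxdotC e) !mxdotBl !(mxdotC _ (_ - _)) !mxdotBl.
  rewrite (mxdotC e v) v1 e1.
  by field.
pose H := 1%:M - (2 / c) *: (w^T *m w).
have HT : H^T = H by rewrite /H linearB linearZ /= trmx1 trmx_mul trmxK.
exists H; split=> //.
  have NN : w^T *m w *m (w^T *m w) = c *: (w^T *m w).
    by rewrite mulmxA -(mulmxA w^T) dotE mul_mx_scalar -scalemxAl.
  rewrite /orthogonal_mx HT /H; move: (w^T *m w) NN => N NN.
  rewrite mulmxBl mul1mx mulmxBr mulmx1 -scalemxAl -scalemxAr NN !scalerA.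
  have -> : 2 / c * (2 / c) * c = 2 / c + 2 / c by field.
  by rewrite scalerDl opprB addrK subrK.
rewrite rowE -/e /H mulmxBr mulmx1 -scalemxAr mulmxA dotE ew.
rewrite mul_scalar_mx scalerA.
have -> : 2 / c * - (c / 2) = -1 by field.
by rewrite scaleN1r opprK /w addrC subrK.
Qed.

(** Deflation: a reflection whose first row is a unit eigenvector conjugates [A] to a matrix with
    first row [a *: e]. By symmetry the first column is of the same form, and induction applies to
    the remaining block. *)
Lemma symmetric_spectral n (A : 'M[R]_n) : A^T = A ->
  exists Q (d : 'rV[R]_n), orthogonal_mx Q /\ A = Q^T *m diag_mx d *m Q.
Proof.
elim: n A => [|n IH] A AT.
  exists 1%:M, 0; split; last by apply/matrixP => -[].
  by rewrite /orthogonal_mx trmx1 mul1mx.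
have [a /eigenvalueP[u uA u0]] := symmetric_eigenvalue AT.
have up : 0 < mxdot u u.
  by rewrite lt_def mxdot_ge0 andbT; apply: contra_neq u0 => /mxdot_eq0.
pose v := (Num.sqrt (mxdot u u))^-1 *: u.
have v1 : mxdot v v = 1.
  rewrite mxdotZl mxdotC mxdotZl mulrA -invfM -expr2 sqr_sqrtr ?mulVf ?gt_eqF//.
  exact: ltW.
have vA : v *m A = a *: v by rewrite -scalemxAl uA !scalerA mulrC.
have [H [Ho HT Hv]] := orthogonal_extend v1.
have HH : H *m H = 1%:M by rewrite -{1}HT.
pose A1 : 'M[R]_(1 + n) := H *m A *m H.
have A1T : A1^T = A1 by rewrite /A1 !trmx_mul AT HT mulmxA.
have A1r : row 0 A1 = a *: delta_mx 0 0.
  rewrite /A1 !row_mul Hv vA -scalemxAl -Hv -row_mul HH row1//.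
have AA1 : A = H *m A1 *m H by rewrite /A1 !mulmxA HH mul1mx -mulmxA HH mulmx1.
clearbody A1.
have A1E : A1 = block_mx a%:M 0 0 (drsubmx A1).
  have ur : ursubmx A1 = 0.
    apply/matrixP => i j; have /rowP/(_ (rshift 1 j)) := A1r.
    by rewrite !mxE ord1 /= mulr0 => <-; congr (A1 _ _); exact: val_inj.
  rewrite -{1}(submxK A1) ur; congr block_mx; last first.
    by rewrite -[LHS]trmxK trmx_dlsub A1T ur trmx0.
  rewrite [LHS]mx11_scalar; congr (_%:M); have /rowP/(_ 0) := A1r.
  by rewrite !mxE !eqxx mulr1 => <-; congr (A1 _ _); exact: val_inj.
have [|Q' [d' [Q'o A'E]]] := IH (drsubmx A1); first by rewrite trmx_drsub A1T.
pose Q1 : 'M[R]_(1 + n) := block_mx 1%:M 0 0 Q'.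
have Q1o : orthogonal_mx Q1.
  rewrite /orthogonal_mx /Q1 tr_block_mx mulmx_block !trmx0 trmx1 Q'o.
  by rewrite !(mulmx0, mul0mx, mulmx1, addr0, add0r) -scalar_mx_block.
have A1Q : A1 = Q1^T *m diag_mx (row_mx a%:M d' : 'rV[R]_(1 + n)) *m Q1.
  rewrite {1}A1E A'E diag_mx_row /Q1 tr_block_mx !mulmx_block.
  rewrite !(mulmx0, mul0mx, mulmx1, addr0, add0r, trmx0, trmx1, mul1mx).
  by congr block_mx; apply/matrixP => i j; rewrite !ord1 !mxE eqxx.
exists (Q1 *m H), (row_mx a%:M d'); split; first exact: orthogonal_mul.
by rewrite AA1 A1Q trmx_mul HT !mulmxA.
Qed.

Lemma spectral_entry n (Q : 'M[R]_n) (d : 'rV[R]_n) i j :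
  (Q^T *m diag_mx d *m Q) i j = \sum_l d 0 l * (Q l i * Q l j).
Proof.
rewrite mxE; apply: eq_bigr => l _.
by rewrite mul_mx_diag !mxE mulrAC mulrC mulrA.
Qed.

Lemma symmetric_spectral_sorted n (A : 'M[R]_n) : A^T = A ->
  exists Q (d : 'rV[R]_n), [/\ orthogonal_mx Q, A = Q^T *m diag_mx d *m Q &
    forall i j : 'I_n, (i <= j)%N -> d 0 j <= d 0 i].
Proof.
move=> /symmetric_spectral[Q [d [Qo AE]]].
pose t := [tuple d 0 i | i < n]; pose t' := [tuple of sort >=%R t].
have /tuple_permP[p pE] : perm_eq t' t by rewrite perm_sort.
have t'E i : tnth t' i = d 0 (p i).
  rewrite (_ : t' = [tuple tnth t (p i) | i < n]) ?tnth_mktuple//.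
  exact: val_inj.
exists (row_perm p Q), (\row_i tnth t' i); split.
- apply/matrixP => i j; rewrite -Qo !mxE [RHS](reindex_inj (@perm_inj _ p)).
  by apply: eq_bigr => l _; rewrite !mxE.
- apply/matrixP => i j; rewrite AE !spectral_entry (reindex_inj (@perm_inj _ p)).
  by apply: eq_bigr => l _; rewrite !mxE t'E.
- move=> i j ij; rewrite !mxE !(tnth_nth 0).
  have s : sorted >=%R t' by apply: sort_sorted => x y; exact: le_total.
  have := @sorted_leq_nth _ _ (rev_trans le_trans) (@lexx _ _) 0 _ s i j.
  by apply=> //; rewrite inE size_tuple.
Qed.

End Spectral.

(** * Almost all symmetric matrices have simple spectrum *)

Section PolynomialFunctions.
Context (R : realType).
Local Notation RT := (measurableTypeR R).

(** Polynomial functions are generated by their closure properties, so that measurability and the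
    behaviour on slices follow by induction. *)
Inductive poly_fun d : (d.-tuple RT -> R) -> Prop :=
| poly_fun_cst (x : R) : poly_fun (fun=> x)
| poly_fun_tnth i : poly_fun (fun t => tnth t i)
| poly_funD f g : poly_fun f -> poly_fun g -> poly_fun (fun t => f t + g t)
| poly_funM f g : poly_fun f -> poly_fun g -> poly_fun (fun t => f t * g t).

Lemma poly_fun_sum d I (r : seq I) (F : I -> d.-tuple RT -> R) :
  (forall i, poly_fun (F i)) -> poly_fun (fun t => \sum_(i <- r) F i t).
Proof.
move=> pF; elim: r => [|i r IH].
  by under eq_fun do rewrite big_nil; exact: poly_fun_cst.
by under eq_fun do rewrite big_cons; exact: poly_funD.
Qed.

Lemma poly_fun_prod d I (r : seq I) (F : I -> d.-tuple RT -> R) :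
  (forall i, poly_fun (F i)) -> poly_fun (fun t => \prod_(i <- r) F i t).
Proof.
move=> pF; elim: r => [|i r IH].
  by under eq_fun do rewrite big_nil; exact: poly_fun_cst.
by under eq_fun do rewrite big_cons; exact: poly_funM.
Qed.

Lemma poly_fun_det d n (M : d.-tuple RT -> 'M[R]_n) :
  (forall i j, poly_fun (fun t => M t i j)) -> poly_fun (fun t => \det (M t)).
Proof.
move=> pM; rewrite /determinant; apply: poly_fun_sum => s.
by apply: poly_funM; [exact: poly_fun_cst|apply: poly_fun_prod => i; exact: pM].
Qed.

Lemma measurable_poly_fun d (f : d.-tuple RT -> R) :
  poly_fun f -> measurable_fun setT (f : _ -> RT).
Proof.
elim=> [x|i|g h _ mg _ mh|g h _ mg _ mh].
- exact: measurable_cst.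
- exact: measurable_tnth.
- exact: measurable_funD.
- exact: measurable_funM.
Qed.

Lemma poly_fun_head d (f : d.+1.-tuple RT -> R) (t : d.-tuple RT) :
  poly_fun f -> exists p : {poly R}, forall x : RT, f (tcons (x, t)) = p.[x].
Proof.
elim=> [c|i|g h _ [p pE] _ [q qE]|g h _ [p pE] _ [q qE]].
- by exists c%:P => x; rewrite hornerC.
- case: (unliftP ord0 i) => [j|] ->.
    by exists (tnth t j)%:P => x; rewrite hornerC /tcons tnthS.
  by exists 'X => x; rewrite hornerX /tcons (tnth_nth x).
- by exists (p + q) => x; rewrite hornerD pE qE.
- by exists (p * q) => x; rewrite hornerM pE qE.
Qed.

Lemma poly_fun_tail d (f : d.+1.-tuple RT -> R) (x : RT) :
  poly_fun f -> poly_fun (fun t : d.-tuple RT => f (tcons (x, t))).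
Proof.
elim=> [c|i|g h _ pg _ ph|g h _ pg _ ph].
- exact: poly_fun_cst.
- case: (unliftP ord0 i) => [j|] ->.
    have -> : (fun t : d.-tuple RT => tnth (tcons (x, t)) (lift ord0 j)) =
        fun t => tnth t j by apply/funext => t; rewrite /tcons tnthS.
    exact: poly_fun_tnth.
  have -> : (fun t : d.-tuple RT => tnth (tcons (x, t)) ord0) = fun=> x.
    by apply/funext => t; rewrite /tcons (tnth_nth x).
  exact: poly_fun_cst.
- exact: poly_funD.
- exact: poly_funM.
Qed.

Lemma poly_roots_finite (p : {poly R}) :
  p != 0 -> finite_set [set x | root p x].
Proof.
move=> p0; suff [s sP] : exists s : seq R, forall x, root p x -> x \in s.
  by apply: sub_finite_set (finite_seq s) => x; exact: sP.
have [N] := ubnP (size p); elim: N p p0 => // N IH p p0.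
have [[x /factor_theorem[q pE]]|nr _] := pselect (exists x, root p x); last first.
  by exists [::] => x rx; exfalso; apply: nr; exists x.
have q0 : q != 0 by apply: contra_neq p0 => q0; rewrite pE q0 mul0r.
rewrite pE size_Mmonic ?monicXsubC// size_XsubC addn2 /= ltnS => qN.
have [s sP] := IH q q0 qN; exists (x :: s) => y.
by rewrite rootM root_XsubC inE orbC => /orP[->//|/sP ->]; rewrite orbT.
Qed.

(* Fubini: off the finitely many roots of a nonzero polynomial in the first
   variable, the slice is the zero set of a nonzero polynomial in the others. *)
Lemma poly_fun_zeros_null d (f : d.-tuple RT -> R) :
  poly_fun f -> (exists t, f t != 0) -> lebesgue_tuple [set t | f t = 0] = 0%E.
Proof.
elim: d f => [|d IH] f pf [t0 ft0].
  rewrite (_ : [set _ | _] = set0) ?measure0//; apply/seteqP; split=> // t /= ft.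
  by move: ft0; rewrite (tuple0 t0) -(tuple0 t) ft eqxx.
rewrite /= /pushforward.
set A := (X in (_ \x _)%E X).
have mA : measurable A.
  rewrite /A -[X in measurable X]setTI; apply: measurable_tcons => //.
  rewrite -[X in measurable X]setTI.
  exact: (measurable_poly_fun pf measurableT (measurable_set1 0)).
have [x0 [t1 t0E]] : exists x t, t0 = tcons (x, t).
  by exists (thead t0), [tuple of behead t0]; rewrite [LHS]tuple_eta.
have [p pE] := poly_fun_head t1 pf.
have p0 : p != 0.
  by apply: contra_neq ft0 => p0; rewrite t0E pE p0 horner0.
rewrite /product_measure1.
rewrite (@ae_eq_integral _ _ _ _ setT (cst 0%E))//.
- by rewrite integral0.
- exact: measurable_fun_xsection.
have cp := finite_set_countable (poly_roots_finite p0).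
exists [set x | root p x]; split.
- by apply: countable_measurable => //; exact: measurable_set1.
- exact: countable_lebesgue_measure0.
move=> x /=; apply: contra_notP => /negP rx _.
rewrite -(IH (fun t => f (tcons (x, t)))).
- by congr (lebesgue_tuple _); apply/seteqP; split=> t; rewrite /xsection /= inE.
- exact: poly_fun_tail.
- by exists t1; rewrite pE.
Qed.

End PolynomialFunctions.

(** * The Krylov determinant of a symmetric matrix *)

Section Krylov.
Context (R : realType) (n : nat).
Local Notation RT := (measurableTypeR R).

Definition krylov_row (A : 'M[R]_n) (i : nat) : 'rV[R]_n :=
  iter i (mulmx^~ A) (const_mx 1).

Definition krylov (A : 'M[R]_n) : 'M[R]_n := \matrix_(i < n) krylov_row A i.

(** With [v] the all-ones row and [D = diag_mx d], [v A^l = (v Q^T) D^l Q]. Exchanging the roles of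
    the row [v Q^T] and the diagonal [D^l] turns the powers of [d] into row [l] of a Vandermonde
    matrix. *)
Lemma krylov_spectral (Q : 'M[R]_n) (d : 'rV[R]_n) : orthogonal_mx Q ->
  krylov (Q^T *m diag_mx d *m Q) =
  Vandermonde n d *m diag_mx (const_mx 1 *m Q^T) *m Q.
Proof.
move=> /orthogonal_mxC QQ; apply/row_matrixP => i; rewrite rowK !row_mul.
have -> (l : nat) : krylov_row (Q^T *m diag_mx d *m Q) l =
    (\row_j d 0 j ^+ l) *m diag_mx (const_mx 1 *m Q^T) *m Q.
  elim: l => [|l IH].
    have -> : (\row_j d 0 j ^+ 0) = const_mx 1.
      by apply/rowP => j; rewrite !mxE expr0.
    have one_diag (u : 'rV[R]_n) : const_mx 1 *m diag_mx u = u.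
      by rewrite mul_mx_diag; apply/rowP => j; rewrite !mxE mul1r.
    rewrite one_diag.
    by rewrite -[in RHS]mulmxA (mulmx1C QQ) mulmx1.
  rewrite /krylov_row iterS -/(krylov_row _ l) IH.
  rewrite -!mulmxA (mulmxA Q Q^T) QQ mul1mx !mulmxA; congr (_ *m Q).
  rewrite -!mulmxA diag_mxC !mulmxA; congr (_ *m _).
  by rewrite mul_mx_diag; apply/rowP => j; rewrite !mxE exprSr.
by congr (_ *m _ *m _); apply/rowP => j; rewrite !mxE.
Qed.

Lemma krylov_simple (Q : 'M[R]_n) (d : 'rV[R]_n) : orthogonal_mx Q ->
  \det (krylov (Q^T *m diag_mx d *m Q)) != 0 -> injective (d 0).
Proof.
move=> Qo; rewrite krylov_spectral// !det_mulmx det_Vandermonde.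
rewrite !mulf_eq0 !negb_or.
move=> /andP[/andP[+ _] _] i j dij.
move=> /prodf_neq0 nz; apply: contra_eq dij => ij.
wlog ltij : i j ij / (i < j)%N.
  move=> W; have : (i < j)%N || (j < i)%N by rewrite -neq_ltn.
  move=> /orP[h|h]; first exact: W.
  by rewrite eq_sym; apply: W => //; rewrite eq_sym.
have /prodf_neq0 /(_ j ltij) := nz i isT.
by rewrite subr_eq0 eq_sym.
Qed.

Lemma krylov_nonzero : exists2 A : 'M[R]_n, A^T = A & \det (krylov A) != 0.
Proof.
(* The eigenvalues [0, 1, ..., n - 1] are distinct and the eigenbasis is the standard one, in which
   the all-ones row has no zero coordinate. *)
exists (diag_mx (\row_i i%:R)); first exact: tr_diag_mx.
have := @krylov_spectral 1%:M (\row_i i%:R).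
rewrite trmx1 mul1mx !mulmx1 => ->; last first.
  by rewrite /orthogonal_mx trmx1 mul1mx.
rewrite det_mulmx det_Vandermonde det_diag mulf_neq0//.
  apply/prodf_neq0 => i _; apply/prodf_neq0 => j ij.
  by rewrite !mxE subr_eq0 eqr_nat gtn_eqF.
by apply/prodf_neq0 => i _; rewrite mxE oner_eq0.
Qed.

(** Inverse of [sym_coord] on symmetric matrices. The pair is put in increasing order before
    [insub], so the default [0] is never reached. *)
Definition sym_of (t : #|{: upper_index n}|.-tuple RT) : 'M[R]_n :=
  \matrix_(i, j) oapp (fun u : upper_index n => tnth t (enum_rank u)) 0
    (insub (if (i <= j)%N then (i, j) else (j, i))).

Lemma sym_coordK (A : 'M[R]_n) : A^T = A -> sym_of (sym_coord A) = A.
Proof.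
move=> AT; apply/matrixP => i j; rewrite mxE; case: ifPn => ij.
  by rewrite insubT /= tnth_mktuple enum_rankK.
rewrite -ltnNge in ij; rewrite insubT /=; first exact: ltnW.
by move=> ji; rewrite tnth_mktuple enum_rankK /= -[in RHS]AT mxE.
Qed.

Lemma poly_fun_sym_of i j : poly_fun (fun t => sym_of t i j).
Proof.
have -> : (fun t => sym_of t i j) =
    (fun t => oapp (fun u : upper_index n => tnth t (enum_rank u)) 0
      (insub (if (i <= j)%N then (i, j) else (j, i)))).
  by apply/funext => t; rewrite mxE.
case: insub => [u|] /=; [exact: poly_fun_tnth|exact: poly_fun_cst].
Qed.

Lemma poly_fun_krylov d (S : d.-tuple RT -> 'M[R]_n) :
  (forall i j, poly_fun (fun t => S t i j)) ->
  poly_fun (fun t => \det (krylov (S t))).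
Proof.
move=> pS; apply: poly_fun_det => i j; under eq_fun do rewrite mxE.
elim: (nat_of_ord i) j => [|l IH] j; rewrite /krylov_row /=.
  by under eq_fun do rewrite mxE; exact: poly_fun_cst.
under eq_fun do rewrite mxE.
by apply: poly_fun_sum => h; exact: poly_funM.
Qed.

(** The coordinates of the exceptional matrices lie in the zero set of [f], a polynomial that does
    not vanish identically by [krylov_nonzero]. *)
Lemma almost_all_simple_spectrum (P : 'M[R]_n -> Prop) :
  (forall A, A^T = A -> \det (krylov A) != 0 -> P A) -> almost_all_symmetric P.
Proof.
move=> AP; pose f t := \det (krylov (sym_of t)).
have pf : poly_fun f := poly_fun_krylov poly_fun_sym_of.
exists [set t | f t = 0]; split.
- rewrite -[X in measurable X]setTI.
  exact: (measurable_poly_fun pf measurableT (measurable_set1 0)).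
- apply: poly_fun_zeros_null => //.
  have [A AT A0] := krylov_nonzero; exists (sym_coord A).
  by rewrite /f sym_coordK.
- move=> _ [A [AT nP] <-] /=; apply/eqP; apply: contra_notT nP => A0.
  by apply: AP => //; rewrite -(sym_coordK AT).
Qed.

End Krylov.

(** * Dominant eigenspace and spectral gap *)

Section DominantProjector.
Context (R : realType) (m k : nat).
Local Notation n := (m + k)%N.
Local Notation E := (block_mx 1%:M 0 0 0 : 'M[R]_(m + k)).

Lemma proj_of_Gr (Q : 'M[R]_n) : orthogonal_mx Q -> Gr (proj_of Q).
Proof.
move=> /orthogonal_mxC QQ; split; rewrite /proj_of.
- by rewrite !trmx_mul trmxK tr_corner mulmxA.
- by rewrite !mulmxA -(mulmxA _ Q) QQ mulmx1 -(mulmxA Q^T) corner_idem.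
- by rewrite -mulmxA mxtrace_mulC -mulmxA QQ mulmx1 mxtrace_corner.
Qed.

Lemma char_poly_spectral p (Q : 'M[R]_p) (d : 'rV[R]_p) : orthogonal_mx Q ->
  char_poly (Q^T *m diag_mx d *m Q) = \prod_i ('X - (d 0 i)%:P).
Proof.
move=> Qo; transitivity (char_poly (diag_mx d)); last first.
  rewrite char_poly_trig ?diag_mx_is_trig//.
  by apply: eq_bigr => i _; rewrite mxE eqxx.
pose q := map_mx polyC Q.
have qq : q^T *m q = 1%:M by rewrite map_trmx -map_mxM Qo map_mx1.
rewrite /char_poly; have -> : char_poly_mx (Q^T *m diag_mx d *m Q) =
    q^T *m char_poly_mx (diag_mx d) *m q.
  rewrite /char_poly_mx mulmxBr mulmxBl mul_mx_scalar -scalemxAl qq scalemx1.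
  by rewrite !map_mxM /q map_trmx.
rewrite !det_mulmx mulrC mulrA -det_mulmx (mulmx1C qq) det1 mul1r//.
Qed.

Variables (Q : 'M[R]_n) (d : 'rV[R]_n).
Hypotheses (Qo : orthogonal_mx Q)
  (d_sorted : forall i j : 'I_n, (i <= j)%N -> d 0 j <= d 0 i)
  (d_inj : injective (d 0)).
Local Notation A := (Q^T *m diag_mx d *m Q).

Lemma dominant_projectorP : dominant_projector A (proj_of Q).
Proof.
split; first exact: proj_of_Gr.
pose s := [tuple d 0 i | i < n].
have nth_s (i : 'I_n) : nth 0 s i = d 0 i by rewrite -tnth_nth tnth_mktuple.
have take_s a : a \in take m s -> exists i : 'I_m, a = d 0 (lshift k i).
  have sz : size (take m s) = m by rewrite size_takel// size_tuple leq_addr.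
  move=> sa; have im : (index a (take m s) < m)%N.
    by rewrite -[ltnRHS]sz index_mem.
  by exists (Ordinal im); rewrite -nth_s -(nth_take 0 im) nth_index.
have s_take (i : 'I_m) : d 0 (lshift k i) \in take m s.
  rewrite -nth_s -(nth_take 0 (ltn_ord i)) mem_nth//.
  by rewrite size_takel ?size_tuple ?leq_addr.
exists s; split.
- apply/(sortedP 0) => i; rewrite size_tuple => iN.
  have := nth_s (Ordinal iN); have := nth_s (Ordinal (ltnW iN)) => /= -> ->.
  exact: d_sorted.
- by rewrite char_poly_spectral// big_map big_enum.
have QQ := orthogonal_mxC Qo.
have QA : Q *m A = diag_mx d *m Q by rewrite !mulmxA QQ mul1mx.
apply/eqmxP/andP; split.
  (* The nonzero rows of [E *m Q] are the first [m] rows of [Q], which are eigenvectors for the [m]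
     largest eigenvalues. *)
  apply: submx_trans (_ : (E *m Q <= _)%MS).
    by rewrite /proj_of -mulmxA submxMl.
  apply/row_subP => i; rewrite row_mul.
  case: (split_ordP i) => j ->.
    have -> : row (lshift k j) E = delta_mx 0 (lshift k j).
      by rewrite rowKu row_row_mx row0 row1 delta_mx_lshift.
    rewrite -rowE.
    apply: submx_trans (_ : (eigenspace A (d 0 (lshift k j)) <= _)%MS).
      apply/eigenspaceP.
      by rewrite -row_mul QA row_mul row_diag_mx -scalemxAl -rowE.
    by rewrite (big_rem _ (s_take j)) /= addsmxSl.
  have -> : row (rshift m j) E = 0 by rewrite rowKd row_row_mx !row0 row_mx0.
  by rewrite mul0mx sub0mx.
rewrite big_seq; apply: (big_ind (fun X => (X <= proj_of Q)%MS)).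
- exact: sub0mx.
- by move=> X Y XP YP; rewrite addsmx_sub XP.
move=> a /take_s[i ->]; set a' := d 0 _.
(* In the eigenbasis, a row in the eigenspace of [a'] is supported where [d] equals [a']. By [d_inj]
   this excludes the last [k] coordinates, so [E] fixes the row. *)
suff -> : eigenspace A a' = eigenspace A a' *m proj_of Q by exact: submxMl.
set W := eigenspace A a'.
have /eigenspaceP WA : (W <= eigenspace A a')%MS by exact: submx_refl.
pose Y := W *m Q^T.
have YD : Y *m diag_mx d = a' *: Y.
  by rewrite /Y scalemxAl -WA -!mulmxA QQ mulmx1.
have YE : Y *m E = Y.
  rewrite -[in LHS](hsubmxK Y) mul_row_block !mulmx0 mulmx1 !addr0 -[RHS]hsubmxK.
  congr row_mx; apply/esym/matrixP => p q; rewrite [RHS]mxE.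
  have := congr1 (fun X : 'M[R]_(m + k) => X p (rshift m q)) YD.
  rewrite mul_mx_diag !mxE => /eqP; rewrite mulrC -subr_eq0 -mulrBl mulf_eq0.
  rewrite subr_eq0 => /orP[/eqP/d_inj/eqP|/eqP//].
  by rewrite eq_rlshift.
by rewrite /proj_of !mulmxA -/Y YE /Y -mulmxA Qo mulmx1.
Qed.

End DominantProjector.

(** * A spectral gap from sorted distinct eigenvalues *)

Section Gap.
Context (R : realType) (m k : nat).
Local Notation n := (m + k)%N.
Local Notation E := (block_mx 1%:M 0 0 0 : 'M[R]_(m + k)).

Lemma mxdot_mulr p q r (U : 'M[R]_(p, q)) (M : 'M[R]_(p, r)) (V : 'M[R]_(r, q)) :
  mxdot U (M *m V) = mxdot (M^T *m U) V.
Proof. by rewrite /mxdot trmx_mul mulmxA mxtrace_mulC mulmxA. Qed.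

Lemma spectral_gap_conj (a b c : R) (B P T : 'M[R]_n) : orthogonal_mx T ->
  spectral_gap a b c B P -> spectral_gap a b c (T *m B *m T^T) (T *m P *m T^T).
Proof.
move=> To gap p U; have TT := orthogonal_mxC To.
have := gap p (T^T *m U).
rewrite (frob_orthl U (orthogonal_tr To)).
have -> : mxdot U (T *m B *m T^T *m U) = mxdot (T^T *m U) (B *m (T^T *m U)).
  by rewrite -!mulmxA mxdot_mulr.
have -> : frob (T *m P *m T^T *m U) = frob (P *m (T^T *m U)).
  by rewrite -!mulmxA frob_orthl.
have -> // : frob ((1%:M - T *m P *m T^T) *m U) = frob ((1%:M - P) *m (T^T *m U)).
rewrite -[RHS](frob_orthl _ To); congr frob.
rewrite !mulmxA mulmxBr mulmx1; congr (_ *m U).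
by rewrite mulmxBl TT.
Qed.

Lemma mxdot_diag_ge p q (x : R) (d : 'rV[R]_p) (W : 'M[R]_(p, q)) :
  (forall i, x <= d 0 i) -> x * frob W ^+ 2 <= mxdot W (diag_mx d *m W).
Proof.
move=> xd; rewrite frob_sqr !mxdotE mulr_sumr; apply: ler_sum => i _.
rewrite mulr_sumr; apply: ler_sum => j _.
by rewrite mul_diag_mx mxE [leRHS]mulrCA ler_wpM2r// -expr2 sqr_ge0.
Qed.

Lemma mxdot_diag_le p q (x : R) (d : 'rV[R]_p) (W : 'M[R]_(p, q)) :
  (forall i, d 0 i <= x) -> mxdot W (diag_mx d *m W) <= x * frob W ^+ 2.
Proof.
move=> xd; rewrite frob_sqr !mxdotE mulr_sumr; apply: ler_sum => i _.
rewrite mulr_sumr; apply: ler_sum => j _.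
by rewrite mul_diag_mx mxE [leLHS]mulrCA ler_wpM2r// -expr2 sqr_ge0.
Qed.

(** Both inequalities split over the blocks of [U = (X; Y)]: the lower bound needs [a] on the top
    block and [a - c] on the bottom one, the upper bound [b + c] and [b]. *)
Lemma spectral_gap_diag (a b c : R) (d : 'rV[R]_n) :
  (forall i : 'I_m, a <= d 0 (lshift k i) <= b + c) ->
  (forall i : 'I_k, a - c <= d 0 (rshift m i) <= b) ->
  spectral_gap a b c (diag_mx d) E.
Proof.
move=> d1 d2 p U; rewrite -(vsubmxK U) -(hsubmxK d) diag_mx_row.
move: (usubmx U) (dsubmx U) => X Y.
have -> : 1%:M - E = block_mx 0 0 0 1%:M.
  by rewrite scalar_mx_block opp_block_mx add_block_mx !subr0 subrr.
rewrite !mul_block_col !mul0mx !mul1mx !addr0 !add0r frob_col_mx0 frob_col_0mx.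
rewrite mxdot_col frob_sqr mxdot_col -!frob_sqr.
have h1 : a * frob X ^+ 2 <= mxdot X (diag_mx (lsubmx d) *m X).
  by apply: mxdot_diag_ge => i; rewrite mxE; case/andP: (d1 i).
have h2 : mxdot X (diag_mx (lsubmx d) *m X) <= (b + c) * frob X ^+ 2.
  by apply: mxdot_diag_le => i; rewrite mxE; case/andP: (d1 i).
have h3 : (a - c) * frob Y ^+ 2 <= mxdot Y (diag_mx (rsubmx d) *m Y).
  by apply: mxdot_diag_ge => i; rewrite mxE; case/andP: (d2 i).
have h4 : mxdot Y (diag_mx (rsubmx d) *m Y) <= b * frob Y ^+ 2.
  by apply: mxdot_diag_le => i; rewrite mxE; case/andP: (d2 i).
by split; lra.
Qed.

Lemma spectral_gap_exists (Q : 'M[R]_n) (d : 'rV[R]_n) : (1 <= m)%N ->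
  orthogonal_mx Q -> (forall i j : 'I_n, (i <= j)%N -> d 0 j <= d 0 i) ->
  injective (d 0) ->
  exists a b c, [/\ b < a, 0 <= c &
    spectral_gap a b c (Q^T *m diag_mx d *m Q) (proj_of Q)].
Proof.
move=> m0 Qo ds di.
have m1 : (m.-1 < m)%N by rewrite prednK.
(* Indices start at 0, so this is the m-th eigenvalue; [b] will be the next one. *)
pose a := d 0 (lshift k (Ordinal m1)).
have [b ba db] : exists2 b, b < a & forall i : 'I_k, d 0 (rshift m i) <= b.
  (* If [k = 0] there is no next eigenvalue, and any number below [a] will do. *)
  have [k0|k0] := posnP k.
    exists (a - 1); first by rewrite gtrBl.
    by move=> i; have := ltn_ord i; rewrite [in ltnRHS]k0.
  exists (d 0 (rshift m (Ordinal k0))).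
    rewrite lt_neqAle ds /= ?addn0 ?(ltnW m1)// andbT; apply/eqP => /di/eqP.
    by rewrite eq_rlshift.
  by move=> i; apply: ds; rewrite /= addn0 leq_addr.
pose c := \sum_i `|d 0 i| + `|a| + `|b|.
have dc i : `|d 0 i| <= \sum_i `|d 0 i|.
  by rewrite (bigD1 i)//= lerDl sumr_ge0.
exists a, b, c; split=> //.
  by rewrite /c !addr_ge0// sumr_ge0.
have := @spectral_gap_conj a b c (diag_mx d) E Q^T (orthogonal_tr Qo).
rewrite trmxK; apply; apply: spectral_gap_diag => i.
  rewrite ds/=; last by rewrite -ltnS prednK.
  have := dc (lshift k i); rewrite /c; have := ler_norm (d 0 (lshift k i)).
  have := ler_norm (- b); rewrite normrN; have := normr_ge0 a; lra.
rewrite db andbT; have := dc (rshift m i); rewrite /c.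
have := ler_norm (- d 0 (rshift m i)); rewrite normrN; have := ler_norm a.
have := normr_ge0 b; lra.
Qed.

End Gap.

(** * Local quadratic convergence *)

Section Norms.
Context (R : realType) (p q : nat).
Implicit Types M : 'M[R]_(p, q).

(** The convergence statement uses the maximum norm and the one-step estimate the Frobenius norm;
    this bound and the next one translate between them. *)
Lemma norm_le_frob M : `|M| <= frob M.
Proof.
rewrite /Num.norm /= mx_normrE; apply: bigmax_le; first exact: frob_ge0.
move=> [i j] _ /=; rewrite -sqrtr_sqr ler_sqrt ?mxdot_ge0// mxdotE.
rewrite (bigD1 i)//= (bigD1 j)//= -addrA -expr2 lerDl addr_ge0//.
  by rewrite sumr_ge0// => ? _; rewrite -expr2 sqr_ge0.
by rewrite sumr_ge0// => ? _; rewrite sumr_ge0// => ? _; rewrite -expr2 sqr_ge0.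
Qed.

Lemma frob_le_norm M : frob M <= (p + q)%:R * `|M|.
Proof.
rewrite -(ler_sqr (frob_ge0 _)) ?nnegrE ?mulr_ge0// frob_sqr mxdotE.
have entry i j : M i j * M i j <= `|M| ^+ 2.
  rewrite -expr2 -real_normK ?num_real// ler_sqr ?nnegrE//.
  by rewrite [leRHS]/Num.norm /= mx_normrE (le_bigmax _ _ (i, j)).
apply: le_trans (_ : \sum_(i < p) \sum_(j < q) `|M| ^+ 2 <= _).
  by apply: ler_sum => i _; apply: ler_sum => j _; exact: entry.
rewrite !sumr_const !card_ord -mulrnA -[leLHS]mulr_natl exprMn.
rewrite ler_wpM2r ?sqr_ge0//.
by rewrite -natrX ler_nat sqrnD mulnC (leq_trans _ (leq_addl _ _))// leq_pmull.
Qed.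

End Norms.

(** * From the one-step estimate to local quadratic convergence *)

Section Convergence.
Context (R : realType) (m k : nat).
Local Notation n := (m + k)%N.
Local Notation E := (block_mx 1%:M 0 0 0 : 'M[R]_(m + k)).
Variables (a b c : R) (A P : 'M[R]_n).
Hypotheses (c_ge0 : 0 <= c) (ab : b < a) (AT : A^T = A) (PGr : Gr P)
  (AP : A *m P = P *m A) (gap : spectral_gap a b c A P).

(** The constant of [newton_step_bound], expressed by [A] because conjugation by an orthogonal
    matrix preserves the Frobenius norm. *)
Definition rate : R := 2 * (1 + 16 * frob A / (a - b)).

Lemma rate_gt0 : 0 < rate.
Proof.
rewrite /rate mulr_gt0// ltr_wpDr// divr_ge0 ?mulr_ge0 ?frob_ge0//.
by rewrite subr_ge0 ltW.
Qed.

(** Conjugation by [T] carries the iterate to [E], the target to [Pi] and the next iterate to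
    [Q *m E *m Q^T]. It preserves distances, so [newton_step_bound] applies. *)
Lemma newton_step_quadratic (T : 'M[R]_n) : orthogonal_mx T ->
  4 * c * frob (proj_of T - P) ^+ 2 <= a - b ->
  [/\ exists! Z, sylvester A T Z, orthogonal_mx (newton_step A T) &
      frob (proj_of (newton_step A T) - P)
      <= rate * frob (proj_of T - P) ^+ 2].
Proof.
move=> To small; have TT := orthogonal_mxC To; case: PGr => PT PP trP.
pose B := T *m A *m T^T; pose Pi := T *m P *m T^T.
have BT : B^T = B by rewrite /B !trmx_mul trmxK AT mulmxA.
have PiT : Pi^T = Pi by rewrite /Pi !trmx_mul trmxK PT mulmxA.
have PiPi : Pi *m Pi = Pi.
  by rewrite /Pi !mulmxA -(mulmxA _ T^T) To mulmx1 -(mulmxA T P) PP.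
have trPi : \tr Pi = m%:R by rewrite /Pi mxtrace_mulC mulmxA To mul1mx.
have BPi : B *m Pi = Pi *m B.
  rewrite /B /Pi !mulmxA -(mulmxA _ T^T) To mulmx1 -(mulmxA T A) AP.
  by rewrite -(mulmxA _ T^T T) To mulmx1 mulmxA.
have gapB : spectral_gap a b c B Pi by exact: spectral_gap_conj.
have conjT (X : 'M[R]_n) : frob (T *m X *m T^T) = frob X.
  by rewrite frob_orthr ?trmxK// frob_orthl.
have epsE : frob (E - Pi) = frob (proj_of T - P).
  rewrite -[RHS]conjT mulmxBr mulmxBl; congr (frob (_ - _)).
  by rewrite /proj_of !mulmxA TT mul1mx -mulmxA TT mulmx1.
rewrite -epsE in small *.
have sylU : exists! Z, sylvester A T Z.
  exact: (sylvester_unique c_ge0 BT PiT PiPi gapB ab small).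
have sylE : sylvester A T (sylvester_sol A T).
  by case: sylU => Z [ZE _]; apply: (@xgetPex _ 0); exists Z.
set Z := sylvester_sol A T in sylE.
have [Qo _] := qr_QP (skew_block_unit Z).
have QEQ := qr_skew_block Z.
have stepE : newton_step A T = (qr_Q (block_mx 1%:M Z (- Z^T) 1%:M))^T *m T.
  by rewrite /newton_step -/Z trmx_mul trmxK.
move: (qr_Q _) Qo QEQ stepE => Q Qo QEQ stepE; split=> //.
  by rewrite stepE; apply: orthogonal_mul => //; exact: orthogonal_tr.
have [P'T P'P' trP'] := proj_of_Gr (orthogonal_tr Qo).
have -> : frob (proj_of (newton_step A T) - P) = frob (proj_of Q^T - Pi).
  rewrite -[LHS]conjT mulmxBr mulmxBl stepE; congr (frob (_ - _)).
  rewrite /proj_of trmx_mul trmxK !mulmxA TT mul1mx.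
  by rewrite -(mulmxA _ T T^T) TT mulmx1.
rewrite /rate -(conjT A).
apply: (newton_step_bound c_ge0 BT PiT PiPi trPi BPi gapB ab small sylE) => //.
by rewrite /proj_of trmxK.
Qed.

Lemma locally_quadratic : converges_locally_quadratically A P.
Proof.
(* The three bounds ensure, for an error [e <= r], that [e ^+ 2 <= e], that one step at least halves
   [e], and that the smallness condition [4 * c * e ^+ 2 <= a - b] holds; adding 1 keeps the
   denominator positive when [c = 0]. *)
pose r := Num.min 1 (Num.min (2 * rate)^-1 ((a - b) / (4 * c + 1))).
have r0 : 0 < r.
  rewrite !lt_min ltr01 invr_gt0 mulr_gt0 ?rate_gt0//= divr_gt0 ?subr_gt0//.
  by rewrite ltr_wpDl// mulr_ge0.
have rr : rate * r <= 2^-1.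
  rewrite mulrC -ler_pdivlMr ?rate_gt0// -invfM !ge_min.
  by rewrite lexx orbT.
have rc (e : R) : 0 <= e -> e <= r -> 4 * c * e ^+ 2 <= a - b.
  move=> e0 er; have : e ^+ 2 <= (a - b) / (4 * c + 1).
    apply: le_trans (_ : e * 1 <= _).
      by rewrite expr2 ler_wpM2l// (le_trans er)// ge_min lexx.
    by rewrite mulr1 (le_trans er)// !ge_min lexx !orbT.
  rewrite ler_pdivlMr; last by rewrite ltr_wpDl// mulr_ge0.
  by have := sqr_ge0 e; lra.
pose N : R := (n + n)%:R.
exists [set X | Gr X /\ frob (X - P) <= r], (rate * N ^+ 2).
split; first by move=> X [].
  suff : \forall X \near P, Gr X -> Gr X /\ frob (X - P) <= r by [].
  (* [N] bounds the Frobenius norm by the maximum norm, and [N / (N + 1) <= 1]. *)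
  apply/nbhs_normP; exists (r / (N + 1)) => /=.
    by rewrite divr_gt0// ltr_wpDl.
  move=> X /= XP GX; split=> //; apply: le_trans (frob_le_norm _) _.
  rewrite distrC (le_trans (ler_wpM2l _ (ltW XP)))// -/N mulrCA.
  by rewrite (ler_piMr (ltW r0))// ler_pdivrMr ?mul1r ?lerDl// ltr_wpDl.
move=> T0 [T0o _] [_ T0r].
pose e j := frob (P_seq A T0 j - P).
(* The geometric bound keeps every error below [r], so the one-step estimate stays applicable, and
   it also yields the convergence. *)
have inv j : orthogonal_mx (theta_seq A T0 j) /\ e j <= geometric r 2^-1 j.
  elim: j => [|j [oj ej]]; first by rewrite /geometric /= expr0 mulr1.
  have ejr : e j <= r.
    rewrite (le_trans ej)// /geometric /= (ler_piMr (ltW r0))//.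
    by rewrite exprn_ile1// ?invr_ge0// invf_le1// ler1n.
  have [_ oS eS] := newton_step_quadratic oj (rc _ (frob_ge0 _) ejr).
  split; first by [].
  apply: le_trans eS _; rewrite expr2 mulrA.
  rewrite -/(P_seq A T0 j) -/(e j).
  have e0 : 0 <= e j by exact: frob_ge0.
  have h : rate * e j * e j <= 2^-1 * e j.
    by rewrite ler_wpM2r// (le_trans _ rr)// (ler_wpM2l (ltW rate_gt0)).
  by rewrite (le_trans h)// /geometric /= exprS mulrCA ler_wpM2l.
have ejr j : e j <= r.
  have [_ ej] := inv j; rewrite (le_trans ej)// /geometric /=.
  rewrite (ler_piMr (ltW r0))//.
  by rewrite exprn_ile1// ?invr_ge0// invf_le1// ler1n.
have step j := newton_step_quadratic (proj1 (inv j)) (rc _ (frob_ge0 _) (ejr j)).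
split.
- by move=> j; case: (step j).
- apply/cvgrPdist_le => eps eps0.
  have half1 : `|2^-1 : R| < 1 by rewrite ger0_norm ?invr_ge0// invf_lt1// ltr1n.
  have /cvgr0_norm_le /(_ _ eps0) := cvg_geometric r half1.
  apply: filterS => j; apply: le_trans; rewrite distrC.
  rewrite (le_trans (norm_le_frob _))// (le_trans (proj2 (inv j)))//.
  exact: ler_norm.
- move=> j; case: (step j) => _ _ sj.
  apply: le_trans (norm_le_frob _) _; apply: le_trans sj _.
  rewrite -[leRHS]mulrA (ler_wpM2l (ltW rate_gt0))// -exprMn.
  by rewrite ler_sqr ?nnegrE ?mulr_ge0 ?frob_ge0// frob_le_norm.
Qed.

End Convergence.

Theorem theorem9 (R : realType) (m k : nat) (hm : (1 <= m)%N) :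
  almost_all_symmetric (fun A : 'M[R]_(m + k) =>
    exists Pstar : 'M[R]_(m + k),
      dominant_projector A Pstar /\ converges_locally_quadratically A Pstar).
Proof.
apply: almost_all_simple_spectrum => A AT A0.
have [Q [d [Qo AE ds]]] := symmetric_spectral_sorted AT.
have di : injective (d 0) by apply: (krylov_simple Qo); rewrite -AE.
exists (proj_of Q); rewrite AE; split; first exact: dominant_projectorP.
have [a [b [c [ba c0 gap]]]] := spectral_gap_exists hm Qo ds di.
apply: (locally_quadratic c0 ba _ (proj_of_Gr Qo) _ gap); first by rewrite -AE.
have QQ := orthogonal_mxC Qo.
(* It remains that [A] commutes with the projector: in the eigenbasis, both [E] and [diag_mx d] are
   diagonal. *)
rewrite /proj_of !mulmxA -!(mulmxA _ Q Q^T) QQ !mulmx1; congr (_ *m _).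
rewrite -!mulmxA; congr (_ *m _).
rewrite -(hsubmxK d) diag_mx_row !mulmx_block.
by rewrite !(mulmx0, mul0mx, mulmx1, mul1mx, addr0).
Qed.
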